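(* There is no algorithm that, given an indexed grammar $G$ over a finite alphabet $\Sigma$ and a monoid morphism $\varphi:\Sigma^*\to M_d(\mathbb{Q})$, computes the Zariski (algebraic) closure of $\varphi(L(G))$.
   Context: An indexed grammar is a tuple $G=(V,\Sigma,I,P,S)$ with a finite set $V$ of variables (nonterminals), a finite alphabet $\Sigma$ of terminals, a finite set $I$ of indices, a start variable $S\in V$, and a finite set $P$ of productions of the forms $A\to\alpha$, $A\to Bf$, and $Af\to\alpha$, where $A,B\in V$, $f\in I$, and $\alpha\in(V\cup\Sigma)^*$. Sentential forms are strings of terminals and of variables each carrying a string of indices (a stack). Starting from $S$ with empty index string: applying $A\to\alpha$ to $A$ with index string $\gamma$ replaces it by $\alpha$ where every variable of $\alpha$ receives index string $\gamma$; applying $A\to Bf$ to $A\gamma$ yields $B$ with index string $f\gamma$; applying $Af\to\alpha$ to $A$ with index string $f\gamma$ replaces it by $\alpha$ where every variable of $\alpha$ receives index string $\gamma$. $L(G)$ is the set of terminal words derivable. For $X\subseteq M_d(\mathbb{Q})$, its Zariski closure in $M_d(\overline{\mathbb{Q}})$ is the common zero set of all polynomials in $\mathbb{Q}[x_{ij}]$ vanishing on $X$; computing it means outputting a finite generating set of the vanishing ideal. *)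

(* Defs.v *)
From HB Require Import structures.
From mathcomp Require Import all_boot all_order all_algebra.
From mathcomp Require Import mpoly.
From Stdlib Require List.
Set Implicit Arguments. Unset Strict Implicit. Unset Printing Implicit Defensive.
Import GRing.Theory.
Local Open Scope ring_scope.

Inductive code : Type :=
| CZero : code
| CSucc : code
| CProj : nat -> code
| CComp : code -> seq code -> code
| CPrec : code -> code -> code
| CMu   : code -> code.

Inductive eval : code -> seq nat -> nat -> Prop :=
| ev_zero xs : eval CZero xs 0
| ev_succ xs : eval CSucc xs (head 0%N xs).+1
| ev_proj i xs : eval (CProj i) xs (nth 0%N xs i)
| ev_comp f gs xs ys y :
    evals gs xs ys -> eval f ys y -> eval (CComp f gs) xs y
| ev_prec0 f g xs y : eval f xs y -> eval (CPrec f g) (0%N :: xs) y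
| ev_precS f g k xs r y :
    eval (CPrec f g) (k :: xs) r -> eval g (k :: r :: xs) y ->
    eval (CPrec f g) (k.+1 :: xs) y
| ev_mu f xs n :
    eval f (n :: xs) 0%N ->
    (forall m, (m < n)%N -> exists r, eval f (m :: xs) r.+1) ->
    eval (CMu f) xs n
with evals : seq code -> seq nat -> seq nat -> Prop :=
| evs_nil xs : evals [::] xs [::]
| evs_cons g gs xs y ys :
    eval g xs y -> evals gs xs ys -> evals (g :: gs) xs (y :: ys).

(* Indexed grammars.  Variables and indices are named by natural        *)
(* numbers, terminals are letters a : nat (the alphabet is fixed to be  *)
(* {0, ..., s-1} below).  A symbol of a right-hand side is either a     *)
(* variable (inl A) or a terminal (inr a).  Finiteness of V and I is    *)
(* automatic: only finitely many names occur in the finite rule list.   *)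
Definition symbol := (nat + nat)%type.

Inductive production : Type :=
| PPlain : nat -> seq symbol -> production        (* A -> alpha   *)
| PPush  : nat -> nat -> nat -> production        (* A -> B f     *)
| PPop   : nat -> nat -> seq symbol -> production. (* A f -> alpha *)

Record igrammar : Type := IGrammar { start : nat; prods : seq production }.

(* sentential forms: inl (A, gamma) is variable A with index string gamma
   (head = top), inr a is a terminal *)
Definition sitem := ((nat * seq nat) + nat)%type.

Definition inst (gamma : seq nat) (alpha : seq symbol) : seq sitem :=
  map (fun s => match s with inl B => inl (B, gamma) | inr a => inr a end) alpha.

Inductive step (G : igrammar) : seq sitem -> seq sitem -> Prop :=
| st_plain pre suf A gamma alpha :
    List.In (PPlain A alpha) (prods G) ->
    step G (pre ++ inl (A, gamma) :: suf) (pre ++ inst gamma alpha ++ suf)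
| st_push pre suf A B f gamma :
    List.In (PPush A B f) (prods G) ->
    step G (pre ++ inl (A, gamma) :: suf) (pre ++ inl (B, f :: gamma) :: suf)
| st_pop pre suf A f gamma alpha :
    List.In (PPop A f alpha) (prods G) ->
    step G (pre ++ inl (A, f :: gamma) :: suf) (pre ++ inst gamma alpha ++ suf).

Inductive derives (G : igrammar) : seq sitem -> seq sitem -> Prop :=
| der_refl u : derives G u u
| der_step u v w : step G u v -> derives G v w -> derives G u w.

Definition in_lang (G : igrammar) (w : seq nat) : Prop :=
  derives G [:: inl (start G, [::])] (map inr w).

Definition symbol_terminal_lt (s : nat) (x : symbol) : bool :=
  match x with inl _ => true | inr a => (a < s)%N end.

Definition terminals_below (G : igrammar) (s : nat) : Prop :=
  forall A alpha f, (List.In (PPlain A alpha) (prods G) \/ List.In (PPop A f alpha) (prods G)) ->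
    all (symbol_terminal_lt s) alpha.

(* the monoid morphism Sigma^* -> M_d(Q), Sigma = {0..size ms - 1},
   determined by the images ms of the letters *)
Definition phi (d : nat) (ms : seq 'M[rat]_d) (w : seq nat) : 'M[rat]_d :=
  foldr (fun a M => nth 1%:M ms a *m M) 1%:M w.

(* Polynomials in Q[x_ij] : variables indexed by 'I_(d*d) via mxvec.   *)
Definition mxpt (d : nat) (A : 'M[rat]_d) : 'I_(d * d) -> rat :=
  fun k => mxvec A 0 k.

Definition vanishing_ideal (d : nat) (X : 'M[rat]_d -> Prop)
  (p : {mpoly rat[d * d]}) : Prop :=
  forall A, X A -> p.@[mxpt A] = 0.

Definition ideal_gen (n : nat) (gens : seq {mpoly rat[n]}) (p : {mpoly rat[n]}) : Prop :=
  exists cs : seq {mpoly rat[n]},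
    p = \sum_(i < size gens) cs`_i * gens`_i.

(* Encodings of inputs and outputs (through MathComp's computable       *)
(* countType codings pickle/unpickle).                                  *)
Definition raw_prod (p : production) :
  ((nat * seq symbol) + (nat * nat * nat) + (nat * nat * seq symbol))%type :=
  match p with
  | PPlain A alpha => inl (inl (A, alpha))
  | PPush A B f => inl (inr (A, B, f))
  | PPop A f alpha => inr (A, f, alpha)
  end.

Definition raw_mx (d : nat) (M : 'M[rat]_d) : seq (seq rat) :=
  [seq [seq M i j | j <- enum 'I_d] | i <- enum 'I_d].

Definition encode_input (d : nat) (G : igrammar) (ms : seq 'M[rat]_d) : nat :=
  pickle (d, (start G, map raw_prod (prods G)), map (@raw_mx d) ms).

(* a raw polynomial: list of (exponent vector, coefficient); the exponent
   of variable k : 'I_(d*d) is the k-th entry of the exponent vector *)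
Definition rawpoly := seq (seq nat * rat).

Definition poly_of_raw (n : nat) (r : rawpoly) : {mpoly rat[n]} :=
  \sum_(t <- r) t.2 *: 'X_[ [multinom nth 0%N t.1 i | i < n] ].

Definition decode_output (n : nat) (out : nat) : option (seq {mpoly rat[n]}) :=
  match unpickle out : option (seq rawpoly) with
  | Some rs => Some (map (@poly_of_raw n) rs)
  | None => None
  end.

Definition computes_zariski_closure (P : code) : Prop :=
  forall (d : nat) (G : igrammar) (ms : seq 'M[rat]_d),
    terminals_below G (size ms) ->
    exists out gens,
      eval P [:: encode_input G ms] out /\
      decode_output (d * d) out = Some gens /\
      (forall p, ideal_gen gens p <->
         vanishing_ideal (fun A => exists w, in_lang G w /\ A = phi ms w) p).

(* Main.v *)
(* By diagonalisation it suffices to encode the halting behaviour of a recursive function c on x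
   in a grammar computable from x, in such a way that the Zariski closure reveals it.  Compile c
   into a counter machine.  The grammar pushes an arbitrary sequence of machine operations on the
   stack and then pops it, copying the stack, so that the stack is read as a polynomial program:
   there are registers for the counters, for a budget b and for an amount u spent, and the output
   carries a factor v, the product of all quantities that have to be nonzero (b at every step, a
   counter before its decrement).  Zero tests cannot be enforced; instead a test on a counter of
   value n > 0 resets it and destroys n units of the budget.  A round may be closed at any time,
   and the next one starts with budget u + 1.  Hence the budget grows from one round to the next
   only if the closed round was an honest run using up the whole budget: b is bounded over all
   words with v <> 0 if the honest runs are bounded, and takes all values otherwise.  The image
   consists of the multiples by powers of 2 of a linear function of (v, v b); in the first case it
   lies on finitely many lines missing the point (0, 1), in the second one (0, 1) is in the
   closure.  This point is made the all-ones matrix, where evaluating a generator only requires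
   summing its coefficients. *)

Require Import Defs.
From mathcomp Require Import all_boot all_order all_algebra.
From mathcomp Require Import mpoly.
From mathcomp Require Import zify ring.
From Stdlib Require Import FunctionalExtensionality.
Import GRing.Theory Num.Theory.
Set Implicit Arguments. Unset Strict Implicit. Unset Printing Implicit Defensive.

(** * Computable functions *)

(** Since [eval] works on untyped lists, the length is fixed so that projections can rebuild the
    whole argument list. *)
Definition computable n (f : seq nat -> nat) :=
  exists c, forall xs, size xs = n -> eval c xs (f xs).

Lemma computable_ext n f g :
  computable n f -> (forall xs, size xs = n -> f xs = g xs) -> computable n g.
Proof. by case=> c cP fg; exists c => xs sz; rewrite -fg //; apply: cP. Qed.

Lemma computable_proj n i : computable n (fun xs => nth 0 xs i).
Proof. by exists (CProj i) => xs _; constructor. Qed.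

Lemma computable_comp m n g (fs : seq (seq nat -> nat)) :
  computable m g -> size fs = m ->
  (forall i, i < size fs -> computable n (nth (fun=> 0) fs i)) ->
  computable n (fun xs => g [seq f xs | f <- fs]).
Proof.
case=> c cP szf fsP.
have [cs csP] : exists cs, forall xs, size xs = n ->
    evals cs xs [seq f xs | f <- fs].
  elim: fs {szf} fsP => [|f fs IH] fsP; first by exists [::] => xs _; constructor.
  have [d dP] := fsP 0 isT.
  have [i lti|cs csP] := IH; first by apply: (fsP i.+1).
  by exists (d :: cs) => xs sz; constructor; [apply: dP | apply: csP].
exists (CComp c cs) => xs sz; apply: ev_comp; first exact: csP.
by apply: cP; rewrite size_map.
Qed.

Lemma computable_comp1 n g f :
  computable 1 (fun ys => g (nth 0 ys 0)) -> computable n f ->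
  computable n (fun xs => g (f xs)).
Proof.
by move=> gP fP; apply: (computable_comp (fs := [:: f]) gP) => // -[].
Qed.

Lemma computable_comp2 n g f1 f2 :
  computable 2 (fun ys => g (nth 0 ys 0) (nth 0 ys 1)) ->
  computable n f1 -> computable n f2 ->
  computable n (fun xs => g (f1 xs) (f2 xs)).
Proof.
by move=> gP f1P f2P; apply: (computable_comp (fs := [:: f1; f2]) gP) => // -[|[]].
Qed.

(** Weakening: the step of a recursion finds its index and accumulator in front of the
    parameters. *)
Lemma computable_drop k n f :
  computable n f -> computable (k + n) (fun xs => f (drop k xs)).
Proof.
move=> fP.
have := @computable_comp n (k + n) f [seq (fun xs => nth 0 xs i) | i <- iota k n] fP.
rewrite size_map size_iota => /(_ erefl) H.
apply: computable_ext (H _) _ => [i lti | xs sz].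
  by rewrite (nth_map 0) ?size_iota //; apply: computable_proj.
congr (f _); rewrite -map_comp; apply: (@eq_from_nth _ 0).
  by rewrite size_map size_iota size_drop sz addKn.
move=> i; rewrite size_map size_iota => lti.
by rewrite (nth_map 0) ?size_iota //= nth_drop nth_iota.
Qed.

Lemma computable_nth_drop k n i :
  computable (k + n) (fun xs => nth 0 (drop k xs) i).
Proof. exact: (@computable_drop k n (fun xs => nth 0 xs i)) (computable_proj _ _). Qed.

Lemma computable_succ n f : computable n f -> computable n (fun xs => (f xs).+1).
Proof.
move=> fP; refine (computable_comp1 (g := succn) _ fP); exists CSucc => -[|x []] // _; exact: ev_succ.
Qed.

Lemma computable_const n k : computable n (fun=> k).
Proof.
elim: k => [|k]; last exact: computable_succ.
by exists CZero => xs _; constructor.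
Qed.

Lemma computable_iteri n f g h :
  computable n f -> computable n g ->
  computable n.+2 (fun ys => h (nth 0 ys 0) (nth 0 ys 1) (drop 2 ys)) ->
  computable n (fun xs => iteri (g xs) (fun k r => h k r xs) (f xs)).
Proof.
case=> cf cfP gP [ch chP].
have recP : computable n.+1
    (fun ys => iteri (nth 0 ys 0) (fun k r => h k r (behead ys)) (f (behead ys))).
  exists (CPrec cf ch) => -[//|k xs] [sz] /=.
  elim: k => [|k IH] /=; first by constructor; apply: cfP.
  apply: ev_precS IH _.
  have := chP (k :: iteri k (fun k0 r => h k0 r xs) (f xs) :: xs).
  by rewrite /= drop0 sz; apply.
have pP i : computable n (fun xs => nth 0 xs i) by apply: computable_proj.
have := @computable_comp n.+1 n _
  (g :: [seq (fun xs => nth 0 xs i) | i <- iota 0 n]) recP.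
rewrite /= size_map size_iota => /(_ erefl) H.
apply: computable_ext (H _) _ => [[|i] lti | xs sz] //=.
  by rewrite (nth_map 0) ?size_iota.
by rewrite -map_comp (eq_map (g := nth 0 xs)) // map_nth_iota0 ?sz // -sz take_size.
Qed.

Lemma computable_iter n f g h :
  computable n f -> computable n g ->
  computable 1 (fun ys => h (nth 0 ys 0)) ->
  computable n (fun xs => iter (g xs) h (f xs)).
Proof.
move=> fP gP hP.
have := @computable_iteri n f g (fun _ r _ => h r) fP gP.
case.
  by apply: computable_comp1 => //; apply: computable_proj.
move=> c cP; exists c => xs sz; have := cP xs sz.
by congr (eval _ _ _); elim: (g xs) => //= k ->.
Qed.

Lemma computable_mu n t g :
  computable n.+1 (fun ys => t (nth 0 ys 0) (drop 1 ys)) ->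
  (forall xs, size xs = n -> t (g xs) xs = 0) ->
  (forall xs m, size xs = n -> m < g xs -> t m xs != 0) ->
  computable n g.
Proof.
case=> c cP t0 tN; exists (CMu c) => xs sz; constructor.
  by have := cP (g xs :: xs); rewrite /= drop0 t0 //; apply; rewrite sz.
move=> m ltm; exists (t m xs).-1; rewrite prednK ?lt0n ?tN //.
by have := cP (m :: xs); rewrite /= drop0; apply; rewrite sz.
Qed.

Ltac computable_var :=
  by [ apply: computable_proj | apply: computable_const
     | exact: (@computable_nth_drop 1) | exact: (@computable_nth_drop 2)].

Lemma computable_add n f g :
  computable n f -> computable n g -> computable n (fun xs => f xs + g xs).
Proof.
move=> fP gP; refine (computable_comp2 (g := addn) _ fP gP).
apply: computable_ext (@computable_iter 2 (fun ys => nth 0 ys 0)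
  (fun ys => nth 0 ys 1) succn _ _ _) _; try computable_var.
  by apply: computable_succ; computable_var.
by move=> xs _; rewrite /= iter_succn addnC.
Qed.

Lemma computable_pred n f : computable n f -> computable n (fun xs => (f xs).-1).
Proof.
move=> fP; refine (computable_comp1 (g := predn) _ fP).
apply: computable_ext (@computable_iteri 1 (fun=> 0)
  (fun ys => nth 0 ys 0) (fun k _ _ => k) _ _ _) _; try computable_var.
by move=> xs _ /=; case: (nth _ _ _).
Qed.

Lemma computable_sub n f g :
  computable n f -> computable n g -> computable n (fun xs => f xs - g xs).
Proof.
move=> fP gP; refine (computable_comp2 (g := subn) _ fP gP).
apply: computable_ext (@computable_iter 2 (fun ys => nth 0 ys 0)
  (fun ys => nth 0 ys 1) predn _ _ _) _; try computable_var.
  by apply: computable_pred; computable_var.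
by move=> xs _; rewrite /= iter_predn.
Qed.

Lemma computable_mul n f g :
  computable n f -> computable n g -> computable n (fun xs => f xs * g xs).
Proof.
move=> fP gP; refine (computable_comp2 (g := muln) _ fP gP).
apply: computable_ext (@computable_iteri 2 (fun=> 0)
  (fun ys => nth 0 ys 1) (fun _ r ys => nth 0 ys 0 + r) _ _ _) _; try computable_var.
  by apply: computable_add; computable_var.
move=> xs _; elim: (nth 0 xs 1) => [|k /= ->]; first by rewrite muln0.
by rewrite mulnS.
Qed.

Lemma computable_exp2 n f : computable n f -> computable n (fun xs => 2 ^ f xs).
Proof.
move=> fP; refine (computable_comp1 (g := expn 2) _ fP).
apply: computable_ext (@computable_iter 1 (fun=> 1)
  (fun ys => nth 0 ys 0) (muln 2) _ _ _) _; try computable_var.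
  by apply: computable_mul; computable_var.
by move=> xs _; elim: (nth _ _ _) => //= k ->; rewrite expnS.
Qed.

Lemma computable_if n (b : seq nat -> bool) f g :
  computable n (fun xs => b xs : nat) -> computable n f -> computable n g ->
  computable n (fun xs => if b xs then f xs else g xs).
Proof.
move=> bP fP gP.
apply: (@computable_ext _ (fun xs => b xs * f xs + (1 - b xs) * g xs)).
  apply: computable_add; apply: computable_mul => //.
  by apply: computable_sub => //; computable_var.
by move=> xs _; case: (b xs); rewrite /= ?mul1n ?mul0n ?addn0.
Qed.

Lemma computable_eq n f g :
  computable n f -> computable n g -> computable n (fun xs => f xs == g xs : nat).
Proof.
move=> fP gP.
apply: (@computable_ext _ (fun xs => 1 - ((f xs - g xs) + (g xs - f xs)))).
  apply: computable_sub; first by computable_var.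
  by apply: computable_add; apply: computable_sub.
by move=> xs _; case: eqP => /=; lia.
Qed.

Lemma computable_leq n f g :
  computable n f -> computable n g -> computable n (fun xs => f xs <= g xs : nat).
Proof.
move=> fP gP; rewrite /leq.
by apply: computable_eq; [apply: computable_sub | computable_var].
Qed.

Lemma computable_neg n (b : seq nat -> bool) :
  computable n (fun xs => b xs : nat) -> computable n (fun xs => ~~ b xs : nat).
Proof.
move=> bP; apply: computable_ext (computable_if bP (computable_const n 0)
  (computable_const n 1)) _ => xs _; by case: (b xs).
Qed.

Lemma computable_and n (a b : seq nat -> bool) :
  computable n (fun xs => a xs : nat) -> computable n (fun xs => b xs : nat) ->
  computable n (fun xs => a xs && b xs : nat).
Proof.
move=> aP bP; apply: computable_ext (computable_if aP bP
  (computable_const n 0)) _ => xs _; by case: (a xs).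
Qed.

Lemma computable_half n f : computable n f -> computable n (fun xs => (f xs)./2).
Proof.
move=> fP; refine (computable_comp1 (g := half) _ fP).
have oddP m h : computable m h -> computable m (fun xs => odd (h xs) : nat).
  move=> hP; refine (computable_comp1 (g := fun x => odd x : nat) _ hP).
  apply: computable_ext (@computable_iter 1 (fun=> 0)
    (fun ys => nth 0 ys 0) (subn 1) _ _ _) _; try computable_var.
    by apply: computable_sub; computable_var.
  by move=> xs _; elim: (nth _ _ _) => //= k ->; case: odd.
apply: computable_ext (@computable_iteri 1 (fun=> 0)
  (fun ys => nth 0 ys 0) (fun k r _ => r + odd k) _ _ _) _; try computable_var.
  by apply: computable_add; [computable_var | apply: oddP; computable_var].
(* Halving advances from [k] to [k.+1] exactly when [k] is odd. *)
move=> xs _; elim: (nth _ _ _) => //= k ->.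
by rewrite uphalf_half addnC.
Qed.

Lemma computable_odd n f : computable n f -> computable n (fun xs => odd (f xs) : nat).
Proof.
move=> fP; apply: (@computable_ext _ (fun xs => f xs - (f xs)./2 * 2)).
  apply: computable_sub => //; apply: computable_mul; last by computable_var.
  exact: computable_half.
by move=> xs _; rewrite -[in LHS](odd_double_half (f xs)) half_bit_double muln2; lia.
Qed.

Lemma computable_sum n g (t : nat -> seq nat -> nat) :
  computable n g ->
  computable n.+1 (fun ys => t (nth 0 ys 0) (drop 1 ys)) ->
  computable n (fun xs => \sum_(k < g xs) t k xs).
Proof.
move=> gP tP.
apply: (@computable_ext _ (fun xs => iteri (g xs) (fun k r => r + t k xs) 0)).
  apply: (computable_iteri (h := fun k r xs => r + t k xs)) => //; first by computable_var.
  apply: computable_add; first by computable_var.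
  have pP := computable_proj.
  have := @computable_comp n.+1 n.+2 _
    ((fun xs => nth 0 xs 0) :: [seq (fun xs => nth 0 xs i) | i <- iota 2 n]) tP.
  rewrite /= size_map size_iota => /(_ erefl) H.
  apply: computable_ext (H _) _ => [[|i] lti | xs sz] //=.
    by rewrite (nth_map 0) ?size_iota.
  rewrite -map_comp drop0; congr (t _ _); apply: (@eq_from_nth _ 0).
    by rewrite size_map size_iota size_drop sz subSS subn1.
  move=> i; rewrite size_map size_iota => lti.
  by rewrite (nth_map 0) ?size_iota //= nth_drop nth_iota.
move=> xs _; elim: (g xs) => [|k /= ->]; first by rewrite big_ord0.
by rewrite big_ord_recr.
Qed.

(** Bounded search for a quotient, which can be taken at most the dividend, even for divisor
    zero. *)
Lemma computable_dvd n f g :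
  computable n f -> computable n g -> computable n (fun xs => f xs %| g xs : nat).
Proof.
move=> fP gP; refine (computable_comp2 (g := fun a b => a %| b : nat) _ fP gP).
apply: (@computable_ext _ (fun xs => ~~ (\sum_(j < (nth 0 xs 1).+1)
    (j * nth 0 xs 0 == nth 0 xs 1) == 0) : nat)).
  apply: computable_neg; apply: computable_eq; last by computable_var.
  apply: (computable_sum (t := fun j xs => j * nth 0 xs 0 == nth 0 xs 1 : nat)).
    by apply: computable_succ; computable_var.
  by apply: computable_eq; [apply: computable_mul|]; computable_var.
move=> xs _; set a := nth 0 xs 0; set b := nth 0 xs 1; congr nat_of_bool.
rewrite sum_nat_eq0; apply/forallPn/dvdnP => /= [[j]|[k bE]].
  by rewrite eqb0 negbK => /eqP <-; exists (nat_of_ord j).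
case: (posnP a) => [a0|a_gt0].
  by exists ord0; rewrite /= bE a0 !muln0.
have ltk : k < b.+1 by rewrite ltnS bE leq_pmulr.
by exists (Ordinal ltk); rewrite /= -bE eqxx.
Qed.

(** Bounded search for a common divisor of at least 2; positivity of [g] makes [g] a bound. This
    serves to recognise reduced fractions. *)
Lemma computable_coprime n f g :
  computable n f -> computable n g ->
  computable n (fun xs => (0 < g xs) && coprime (f xs) (g xs) : nat).
Proof.
move=> fP gP; refine (computable_comp2 (g := fun a d => (0 < d) && coprime a d : nat) _ fP gP).
apply: (@computable_ext _ (fun xs => (0 < nth 0 xs 1) &&
    (\sum_(k < (nth 0 xs 1).+1)
    [&& 2 <= k, k %| nth 0 xs 0 & k %| nth 0 xs 1] == 0) : nat)).
  apply: computable_and; first by apply: computable_leq; computable_var.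
  apply: computable_eq; last by computable_var.
  apply: (computable_sum (t := fun k xs => [&& 2 <= k, k %| nth 0 xs 0 & k %| nth 0 xs 1] : nat)).
    by apply: computable_succ; computable_var.
  do 2?apply: computable_and; first by apply: computable_leq; computable_var.
    by apply: computable_dvd; computable_var.
  by apply: computable_dvd; computable_var.
move=> xs _; set a := nth 0 xs 0; set d := nth 0 xs 1; congr nat_of_bool.
case: (posnP d) => //= d_gt0; rewrite sum_nat_eq0; apply/forallP/idP => /= H.
  apply/negPn/negP => ncop; have gt1 : 1 < gcdn a d.
    by rewrite ltn_neqAle eq_sym ncop gcdn_gt0 d_gt0 orbT.
  have ltk : gcdn a d < d.+1 by rewrite ltnS dvdn_leq ?dvdn_gcdr.
  by have := H (Ordinal ltk); rewrite /= gt1 dvdn_gcdl dvdn_gcdr.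
move=> k; rewrite eqb0; apply/negP => /and3P[k2 ka kd].
have : (k : nat) %| gcdn a d by rewrite dvdn_gcd ka.
by rewrite (eqP H) dvdn1 => /eqP k1; rewrite k1 in k2.
Qed.

(** * Lists coded as numbers *)

Definition pair_code a b := 2 ^ a * b.*2.+1.

(** [pair_code] is the list constructor of MathComp's coding [CodeSeq] and [0] is the empty list, so
    decoding is done with [hd] and [tl]. *)
Definition hd n := head 0 (CodeSeq.decode n).
Definition tl n := CodeSeq.code (behead (CodeSeq.decode n)).

Lemma pair_codeE a b : pair_code a b = CodeSeq.code (a :: CodeSeq.decode b).
Proof. by rewrite /= CodeSeq.decodeK. Qed.

Lemma hd_pair a b : hd (pair_code a b) = a.
Proof. by rewrite /hd pair_codeE CodeSeq.codeK. Qed.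

Lemma tl_pair a b : tl (pair_code a b) = b.
Proof. by rewrite /tl pair_codeE CodeSeq.codeK /= CodeSeq.decodeK. Qed.

Lemma pair_code_hd_tl n : 0 < n -> pair_code (hd n) (tl n) = n.
Proof.
rewrite pair_codeE /tl /hd CodeSeq.codeK -{1 4}[n]CodeSeq.decodeK.
by case: (CodeSeq.decode n).
Qed.

Lemma computable_pair n f g :
  computable n f -> computable n g ->
  computable n (fun xs => pair_code (f xs) (g xs)).
Proof.
move=> fP gP; apply: computable_mul; first exact: computable_exp2.
apply: computable_succ; apply: (@computable_ext _ (fun xs => g xs + g xs)).
  exact: computable_add.
by move=> xs _; rewrite addnn.
Qed.

Lemma iter_half_pair k a b : k <= a -> iter k half (pair_code a b) = pair_code (a - k) b.
Proof.
elim: k => [|k IH] lka; first by rewrite subn0.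
rewrite iterS IH ?(ltnW lka) // /pair_code -(subnSK lka) expnS -mulnA mul2n.
by rewrite doubleK.
Qed.

Lemma iter_half_hd n k :
  0 < n -> k <= hd n -> iter k half n = pair_code (hd n - k) (tl n).
Proof. by move=> n_gt0 lek; rewrite -iter_half_pair // pair_code_hd_tl. Qed.

Lemma computable_iter_half n f g :
  computable n f -> computable n g -> computable n (fun xs => iter (f xs) half (g xs)).
Proof.
move=> fP gP; apply: computable_iter => //; apply: computable_half; computable_var.
Qed.

(** On positive numbers [hd] is the 2-adic valuation, found as the least number of halvings that
    gives an odd number. The guard stops the search at once on [0]. *)
Lemma computable_hd n f : computable n f -> computable n (fun xs => hd (f xs)).
Proof.
move=> fP; refine (computable_comp1 (g := hd) _ fP).
apply: (computable_mu (t := fun k xs => (nth 0 xs 0 != 0) && ~~ odd (iter k half (nth 0 xs 0)))).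
- apply: computable_and.
    by apply: computable_neg; apply: computable_eq; computable_var.
  by apply: computable_neg; apply: computable_odd; apply: computable_iter_half; computable_var.
- move=> xs _; case: (posnP (nth 0 xs 0)) => [-> // | n_gt0].
  rewrite iter_half_hd // subnn.
  by rewrite /pair_code mul1n /= odd_double; case: (nth 0 xs 0).
- move=> xs m _; case: (posnP (nth 0 xs 0)) => [-> // | n_gt0] ltm.
  rewrite iter_half_hd ?(ltnW ltm) //.
  by rewrite /pair_code oddM oddX subn_eq0 leqNgt ltm; case: (nth 0 xs 0) n_gt0.
Qed.

Lemma computable_tl n f : computable n f -> computable n (fun xs => tl (f xs)).
Proof.
move=> fP; apply: (@computable_ext _ (fun xs => (iter (hd (f xs)) half (f xs))./2)).
  by apply: computable_half; apply: computable_iter_half => //; apply: computable_hd.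
move=> xs _; case: (posnP (f xs)) => [-> // | n_gt0].
rewrite iter_half_hd // subnn.
by rewrite /pair_code mul1n /= uphalf_double.
Qed.

Lemma size_decode n : size (CodeSeq.decode n) <= n.
Proof.
rewrite -{2}[n]CodeSeq.decodeK; elim: (CodeSeq.decode n) => //= a s IH.
rewrite -[(size s).+1]mul1n leq_mul ?expn_gt0 // ltnS (leq_trans IH) //.
by rewrite -addnn leq_addr.
Qed.

Lemma computable_foldl n g f s :
  computable 2 (fun ys => g (nth 0 ys 0) (nth 0 ys 1)) ->
  computable n s -> computable n f ->
  computable n (fun xs => foldl g (s xs) (CodeSeq.decode (f xs))).
Proof.
move=> gP sP fP.
pose next st := if hd st == 0 then st else
  pair_code (tl (hd st)) (g (tl st) (hd (hd st))).
apply: (@computable_ext _ (fun xs => tl (iter (f xs) next (pair_code (f xs) (s xs))))).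
  apply: computable_tl; apply: computable_iter => //; first exact: computable_pair.
  have vP := computable_proj 1 0; rewrite /next.
  apply: computable_if => //.
    by apply: computable_eq; [apply: computable_hd | computable_var].
  apply: computable_pair; first by do 2?[apply: computable_tl | apply: computable_hd].
  apply: computable_comp2 => //; first exact: computable_tl.
  by do 2!apply: computable_hd.
move=> xs _; have := size_decode (f xs).
rewrite -[X in pair_code X]CodeSeq.decodeK.
elim: (f xs) (CodeSeq.decode _) (s xs) => [|k IH] [|a l] acc // szl.
- by rewrite tl_pair.
- by rewrite iter_fix ?tl_pair // /next hd_pair.
rewrite iterSr.
have -> : next (pair_code (CodeSeq.code (a :: l)) acc) =
    pair_code (CodeSeq.code l) (g acc a).
  rewrite /next hd_pair tl_pair /hd /tl CodeSeq.codeK.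
  by rewrite [CodeSeq.code _ == 0]muln_eq0 expn_eq0.
by rewrite IH.
Qed.

(** * Testing a decoded output at the all-ones matrix *)

(** MathComp codes an integer through [nat + nat], as a pair of optional numbers; the second one,
    belonging to [Negz], takes precedence in decoding. As [Negz y] is [- (y + 1)], a successor
    appears in [int_neg]. *)
Definition is_pair n := [&& n != 0, tl n != 0 & tl (tl n) == 0].
Definition int_ok n := is_pair n && ~~ ((hd n == 0) && (hd (tl n) == 0)).
Definition int_pos n := if hd (tl n) == 0 then hd (hd n) else 0.
Definition int_neg n := if hd (tl n) == 0 then 0 else (hd (hd (tl n))).+1.

Lemma code_eq0 s : (CodeSeq.code s == 0) = (s == [::]).
Proof. by case: s => //= a s; rewrite muln_eq0 expn_eq0. Qed.

Lemma decodeP n : CodeSeq.decode n = if n == 0 then [::] else hd n :: CodeSeq.decode (tl n).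
Proof.
rewrite /hd /tl CodeSeq.codeK -{2}[n]CodeSeq.decodeK code_eq0.
by case: (CodeSeq.decode n).
Qed.

Lemma decode_pair (T : Type) (f : nat -> nat -> T) x n :
  (if CodeSeq.decode n is [:: a; b] then f a b else x) =
  if is_pair n then f (hd n) (hd (tl n)) else x.
Proof.
rewrite decodeP /is_pair; case: (n == 0) => //=; rewrite decodeP.
by case: (tl n == 0) => //=; rewrite decodeP; case: (tl (tl n) == 0).
Qed.

Lemma unpickle_int n :
  (unpickle n : option int) =
  if int_ok n then Some ((int_pos n)%:Z - (int_neg n)%:Z)%R else None.
Proof.
transitivity (if CodeSeq.decode n is [:: a; b] then
   if CodeSeq.decode b is y :: _ then Some (Negz y) else
   if CodeSeq.decode a is x :: _ then Some (Posz x) else None else None).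
  cbv -[CodeSeq.decode]; case: (CodeSeq.decode n) => [|a [|b []]] //.
  by case: (CodeSeq.decode a) (CodeSeq.decode b) => [|? ?] [].
rewrite (decode_pair (fun a b => if CodeSeq.decode b is y :: _ then Some (Negz y) else
   if CodeSeq.decode a is x :: _ then Some (Posz x) else None)) /int_ok.
case: is_pair => //=; rewrite [CodeSeq.decode (hd (tl n))]decodeP.
rewrite [CodeSeq.decode (hd n)]decodeP /int_pos /int_neg.
case: (hd (tl n) == 0) => /=; first by case: (hd n == 0) => //=; rewrite subr0.
by rewrite andbF /= sub0r.
Qed.

(** [unpickle] rejects a pair of integers that is not a reduced fraction with positive denominator,
    so this has to be tested. *)
Definition rat_ok n := [&& is_pair n, int_ok (hd n), int_ok (hd (tl n)),
  int_neg (hd (tl n)) == 0 &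
  (0 < int_pos (hd (tl n))) && coprime (int_pos (hd n) + int_neg (hd n)) (int_pos (hd (tl n)))].

Lemma int_abs n : `|((int_pos n)%:Z - (int_neg n)%:Z)%R|%N = int_pos n + int_neg n.
Proof. by rewrite /int_pos /int_neg; case: ifP => _; lia. Qed.

Lemma int_negE n : (0 < int_neg n) -> int_pos n = 0.
Proof. by rewrite /int_pos /int_neg; case: ifP. Qed.

Lemma unpickle_rat n :
  match (unpickle n : option rat) with
  | Some r => rat_ok n /\ (r * (int_pos (hd (tl n)))%:R =
       (int_pos (hd n))%:R - (int_neg (hd n))%:R)%R
  | None => ~~ rat_ok n
  end.
Proof.
have -> : (unpickle n : option rat) = if CodeSeq.decode n is [:: a; b] then
   obind insub (obind (fun i => omap (fun j => (i, j)) (unpickle b : option int)) (unpickle a : option int)) else None.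
  rewrite -[LHS]/(obind insub (omap pair_of_tag (unpickle n : option {i : int & int}))).
  rewrite -[unpickle n]/(if CodeSeq.decode n is [:: ni; nx] then
    obind (fun i => omap (@Tagged int i (fun=> int)) (unpickle nx)) (unpickle ni) else None).
  case: (CodeSeq.decode n) => [|a [|b []]] //.
  by case: (unpickle a : option int) => //= i; case: (unpickle b : option int).
rewrite (decode_pair (fun a b => obind insub (obind (fun i =>
  omap (fun j => (i, j)) (unpickle b : option int)) (unpickle a : option int)))) /rat_ok.
case: is_pair => //=; rewrite !unpickle_int.
case: (int_ok (hd n)) => //=; case: (int_ok (hd (tl n))) => //=.
set a := hd n; set b := hd (tl n).
case: insubP => /= [r | ].
  rewrite int_abs int_abs => /andP[b_gt0 cop] rE.
  have b0 : int_neg b = 0.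
    by case: (posnP (int_neg b)) => // /int_negE b0; move: b_gt0; rewrite b0; lia.
  move: b_gt0 cop rE; rewrite b0 addn0 subr0 ltz_nat => b_gt0 cop rE.
  have {}rE : valq r = _ := rE.
  rewrite b_gt0 cop; split=> //.
  rewrite -[r]divq_num_den /numq /denq rE /=.
  rewrite rmorphB /= divfK //.
  by rewrite intr_eq0 eqz_nat -lt0n.
rewrite !int_abs; apply: contraNN => /andP[/eqP -> /andP[b_gt0]].
by rewrite addn0 subr0 ltz_nat b_gt0.
Qed.

Definition term_ok m := is_pair m && rat_ok (hd (tl m)).

(** Addition of fractions, with positive and negative parts kept apart to stay within natural
    numbers. Terms that do not decode are skipped, as [unpickle] on lists drops them. *)
Definition add_term acc m :=
  if term_ok m then
    pair_code
      (hd acc * int_pos (hd (tl (hd (tl m)))) + int_pos (hd (hd (tl m))) * tl (tl acc))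
      (pair_code
        (hd (tl acc) * int_pos (hd (tl (hd (tl m)))) + int_neg (hd (hd (tl m))) * tl (tl acc))
        (tl (tl acc) * int_pos (hd (tl (hd (tl m))))))
  else acc.

(* An accumulator [pair_code p (pair_code q d)] stands for the rational [(p - q) / d]. *)
Definition coef_sum_code m :=
  foldl add_term (pair_code 0 (pair_code 0 1)) (CodeSeq.decode m).

(** Counts the generators that do not vanish at the all-ones point. *)
Definition has_nonroot out :=
  foldl (fun acc m => acc + (hd (coef_sum_code m) != hd (tl (coef_sum_code m))))
    0 (CodeSeq.decode out).

Lemma computable_is_pair n f : computable n f -> computable n (fun xs => is_pair (f xs) : nat).
Proof.
move=> fP; rewrite /is_pair.
do 2?apply: computable_and; first by apply: computable_neg; apply: computable_eq => //; computable_var.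
  by apply: computable_neg; apply: computable_eq; [apply: computable_tl|computable_var].
by apply: computable_eq; [do 2!apply: computable_tl|computable_var].
Qed.

Lemma computable_int_ok n f : computable n f -> computable n (fun xs => int_ok (f xs) : nat).
Proof.
move=> fP; rewrite /int_ok; apply: computable_and; first exact: computable_is_pair.
apply: computable_neg; apply: computable_and.
  by apply: computable_eq; [apply: computable_hd|computable_var].
by apply: computable_eq; [apply: computable_hd; apply: computable_tl|computable_var].
Qed.

Lemma computable_int_pos n f : computable n f -> computable n (fun xs => int_pos (f xs)).
Proof.
move=> fP; rewrite /int_pos; apply: computable_if; last by computable_var.
  by apply: computable_eq; [apply: computable_hd; apply: computable_tl|computable_var].
by do 2!apply: computable_hd.
Qed.

Lemma computable_int_neg n f : computable n f -> computable n (fun xs => int_neg (f xs)).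
Proof.
move=> fP; rewrite /int_neg; apply: computable_if; first 1 last.
- by computable_var.
- by apply: computable_succ; do 2!apply: computable_hd; apply: computable_tl.
by apply: computable_eq; [apply: computable_hd; apply: computable_tl|computable_var].
Qed.

Lemma computable_rat_ok n f : computable n f -> computable n (fun xs => rat_ok (f xs) : nat).
Proof.
move=> fP; have hP := computable_hd fP; have tP := computable_hd (computable_tl fP).
rewrite /rat_ok; apply: computable_and; first exact: computable_is_pair.
apply: computable_and; first exact: computable_int_ok.
apply: computable_and; first exact: computable_int_ok.
apply: computable_and; first by apply: computable_eq; [apply: computable_int_neg|computable_var].
apply: computable_coprime; last exact: computable_int_pos.
by apply: computable_add; [apply: computable_int_pos | apply: computable_int_neg].
Qed.

Lemma computable_has_nonroot n f :
  computable n f -> computable n (fun xs => has_nonroot (f xs)).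
Proof.
move=> fP.
have sumP m g : computable m g -> computable m (fun xs => coef_sum_code (g xs)).
  move=> gP; rewrite /coef_sum_code; apply: computable_foldl => //; last by computable_var.
  have aP := computable_proj 2 0; have rP := computable_hd (computable_tl (computable_proj 2 1)).
  have dP := computable_int_pos (computable_hd (computable_tl rP)).
  have pP := computable_int_pos (computable_hd rP).
  have qP := computable_int_neg (computable_hd rP).
  have cP := computable_tl (computable_tl aP).
  rewrite /add_term; apply: computable_if => //.
    rewrite /term_ok; apply: computable_and; last exact: computable_rat_ok.
    by apply: computable_is_pair; computable_var.
  apply: computable_pair.
    apply: computable_add; apply: computable_mul => //; exact: computable_hd.
  apply: computable_pair; last exact: computable_mul.
  apply: computable_add; apply: computable_mul => //.
  by apply: computable_hd; apply: computable_tl.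
rewrite /has_nonroot; apply: (computable_foldl (g := fun acc m => 
    acc + (hd (coef_sum_code m) != hd (tl (coef_sum_code m))))) => //; last by computable_var.
apply: computable_add; first by computable_var.
have sP := sumP _ _ (computable_proj 2 1).
by apply: computable_neg; apply: computable_eq; apply: computable_hd => //; apply: computable_tl.
Qed.

Local Open Scope ring_scope.

Lemma unpickle_term m :
  match (unpickle m : option (seq nat * rat)) with
  | Some t => term_ok m /\ (t.2 * (int_pos (hd (tl (hd (tl m)))))%:R =
       (int_pos (hd (hd (tl m))))%:R - (int_neg (hd (hd (tl m))))%:R)
  | None => ~~ term_ok m
  end.
Proof.
have -> : (unpickle m : option (seq nat * rat)) = if CodeSeq.decode m is [:: a; b] then
   omap (fun r => (pmap (fun x => Some x) (CodeSeq.decode a), r)) (unpickle b : option rat) else None.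
  rewrite -[LHS]/(omap pair_of_tag (unpickle m : option {i : seq nat & rat})).
  rewrite -[unpickle m]/(if CodeSeq.decode m is [:: ni; nx] then
    obind (fun i => omap (@Tagged (seq nat) i (fun=> rat)) (unpickle nx)) (unpickle ni) else None).
  case: (CodeSeq.decode m) => [|a [|b []]] //.
  rewrite -[unpickle a]/(Some (pmap (fun x => Some x) (CodeSeq.decode a))) /=.
  by case: (unpickle b : option rat).
rewrite (decode_pair (fun a b => omap (fun r => (pmap (fun x => Some x)
  (CodeSeq.decode a), r)) (unpickle b : option rat))) /term_ok.
case: is_pair => //=.
by have := unpickle_rat (hd (tl m)); case: (unpickle _ : option rat).
Qed.

Lemma coef_sum_codeE m :
  (hd (coef_sum_code m) != hd (tl (coef_sum_code m))) =
  (\sum_(t <- pmap unpickle (CodeSeq.decode m) : rawpoly) t.2 != 0).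
Proof.
rewrite /coef_sum_code.
(* The accumulator always represents a rational with positive denominator, so comparing its two
   parts decides whether the sum is zero. *)
suff main s acc (q : rat) : (0 < tl (tl acc))%N ->
    (hd acc)%:R - (hd (tl acc))%:R = (tl (tl acc))%:R * q ->
    let acc' := foldl add_term acc s in
    (0 < tl (tl acc'))%N /\ (hd acc')%:R - (hd (tl acc'))%:R =
      (tl (tl acc'))%:R * (q + \sum_(t <- pmap unpickle s : rawpoly) t.2).
  have [||d_gt0 E] := main (CodeSeq.decode m) (pair_code 0 (pair_code 0 1)) 0.
  - by rewrite !tl_pair.
  - by rewrite !(tl_pair, hd_pair) subrr mulr0.
  rewrite add0r in E; congr (~~ _).
  rewrite -(eqr_nat rat) -subr_eq0 E mulf_eq0 pnatr_eq0.
  by rewrite eqn0Ngt d_gt0.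
elim: s acc q => [|a s IH] acc q d_gt0 E /=.
  by rewrite big_nil addr0.
have := unpickle_term a; case: (unpickle a : option (seq nat * rat)) => [t [ok tE]|nok] /=.
  have d'_gt0 : (0 < int_pos (hd (tl (hd (tl a)))))%N.
    by case/andP: ok => _ /and5P[_ _ _ _ /andP[]].
  rewrite big_cons addrA; apply: IH; first rewrite /add_term ok !(tl_pair, hd_pair).
    by rewrite muln_gt0 d_gt0.
  rewrite /add_term ok !(tl_pair, hd_pair) !natrD !natrM; move: E tE; move: (_%:R) => p.
  move: (int_pos (hd (tl (hd (tl a)))))%:R (hd (tl acc))%:R (tl (tl acc))%:R.
  move: (int_pos _)%:R (int_neg _)%:R => x y u v w E tE.
  have -> : p * u + x * w - (v * u + y * w) = (p - v) * u + w * (x - y) by ring.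
  by rewrite E -tE; ring.
by apply: IH; rewrite /add_term (negbTE nok).
Qed.

Lemma meval_poly_of_raw n (r : rawpoly) :
  (poly_of_raw n r).@[fun=> 1] = \sum_(t <- r) t.2.
Proof.
rewrite /poly_of_raw raddf_sum /=; apply: eq_bigr => t _.
by rewrite mevalZ mevalX big1 ?mulr1 // => i _; rewrite expr1n.
Qed.

Lemma has_nonrootE n out gens :
  decode_output n out = Some gens ->
  (has_nonroot out == 0%N) = all (fun g => g.@[fun=> 1] == 0) gens.
Proof.
rewrite /decode_output.
rewrite -[unpickle out]/(Some (pmap (fun m => Some (pmap unpickle (CodeSeq.decode m))) (CodeSeq.decode out))).
case=> <-; rewrite /has_nonroot.
set F := (fun acc m => _).
suff main s a b : ((a == 0) = b)%N -> (foldl F a s == 0)%N =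
    b && all (fun g => g.@[fun=> 1] == 0)
      [seq poly_of_raw n r | r <- [seq pmap unpickle (CodeSeq.decode m) | m <- s]].
  by rewrite (main _ _ true) //=; congr all; congr map; elim: (CodeSeq.decode out) => //= m s ->.
elim: s a b => [|m s IH] a b ab; first by rewrite /= ab andbT.
rewrite /= meval_poly_of_raw andbA; apply: IH.
by rewrite /F addn_eq0 ab coef_sum_codeE eqb0 negbK.
Qed.

Local Close Scope ring_scope.

(** * Leftmost derivations *)

Lemma In_map (T S : Type) (f : T -> S) y s :
  List.In y (map f s) <-> exists2 x, List.In x s & y = f x.
Proof.
elim: s => [|a s [IH1 IH2]] /=; first by split=> // -[].
split=> [[<-|]|[x [<-|xs] yE]].
- by exists a; [left|].
- by case/IH1 => x xs yE; exists x; [right|].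
- by left.
by right; apply: IH2; exists x.
Qed.

Lemma In_cat (T : Type) (x : T) s1 s2 :
  List.In x (s1 ++ s2) <-> List.In x s1 \/ List.In x s2.
Proof. by elim: s1 => [|a s IH] /=; [split; [right|case]|rewrite IH; tauto]. Qed.

Lemma In_flatten_map (T S : Type) (f : T -> seq S) y s :
  List.In y (flatten (map f s)) <-> exists2 x, List.In x s & List.In y (f x).
Proof.
elim: s => [|a s IH] /=; first by split=> // -[].
rewrite In_cat IH; split=> [[ya|[x xs yx]]|[x [<-|xs] yx]].
- by exists a; [left|].
- by exists x; [right|].
- by left.
by right; exists x.
Qed.

Lemma In_mem (T : eqType) (x : T) s : List.In x s <-> x \in s.
Proof.
elim: s => //= a s IH; rewrite inE IH; split=> [[->|->]|/predU1P[->|]]; rewrite ?eqxx ?orbT //; tauto.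
Qed.

(** Leftmost derivations that strip a terminal as soon as it is in front; this relation decomposes
    along concatenations. *)
Inductive gen (G : igrammar) : seq sitem -> seq nat -> Prop :=
| gen_nil : gen G [::] [::]
| gen_term a u w : gen G u w -> gen G (inr a :: u) (a :: w)
| gen_plain A alpha gamma u w :
    List.In (PPlain A alpha) (prods G) ->
    gen G (inst gamma alpha ++ u) w -> gen G (inl (A, gamma) :: u) w
| gen_push A B f gamma u w :
    List.In (PPush A B f) (prods G) ->
    gen G (inl (B, f :: gamma) :: u) w -> gen G (inl (A, gamma) :: u) w
| gen_pop A f alpha gamma u w :
    List.In (PPop A f alpha) (prods G) ->
    gen G (inst gamma alpha ++ u) w -> gen G (inl (A, f :: gamma) :: u) w.

Lemma gen_cat G u1 u2 w1 w2 : gen G u1 w1 -> gen G u2 w2 -> gen G (u1 ++ u2) (w1 ++ w2).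
Proof.
move=> g1 g2; elim: g1 => //=.
- by move=> a u w _; apply: gen_term.
- by move=> A alpha gamma u w AP _ IH; apply: gen_plain AP _; rewrite catA.
- by move=> A B f gamma u w AP _ IH; apply: gen_push AP _.
by move=> A f alpha gamma u w AP _ IH; apply: gen_pop AP _; rewrite catA.
Qed.

Lemma gen_split G u1 u2 w : gen G (u1 ++ u2) w ->
  exists w1 w2, [/\ w = w1 ++ w2, gen G u1 w1 & gen G u2 w2].
Proof.
move eqv: (u1 ++ u2) => v g; elim: g u1 eqv => {v w}.
- by case=> //= ->; exists [::], [::]; split=> //; constructor.
- move=> a u w g IH [|x u1] /= eqv.
    by exists [::], (a :: w); rewrite eqv; split=> //; constructor.
  case: eqv => -> /IH [w1 [w2 [-> g1 g2]]].
  by exists (a :: w1), w2; split=> //; constructor.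
- move=> A alpha gamma u w AP g IH [|x u1] /= eqv.
    by exists [::], w; rewrite eqv; split=> //; [constructor|apply: gen_plain AP g].
  case: eqv => -> eqv; have [|w1 [w2 [-> g1 g2]]] := IH (inst gamma alpha ++ u1).
    by rewrite -catA eqv.
  by exists w1, w2; split=> //; apply: gen_plain AP g1.
- move=> A B f gamma u w AP g IH [|x u1] /= eqv.
    by exists [::], w; rewrite eqv; split=> //; [constructor|apply: gen_push AP g].
  case: eqv => -> eqv; have [|w1 [w2 [-> g1 g2]]] := IH (inl (B, f :: gamma) :: u1).
    by rewrite /= eqv.
  by exists w1, w2; split=> //; apply: gen_push AP g1.
move=> A f alpha gamma u w AP g IH [|x u1] /= eqv.
  by exists [::], w; rewrite eqv; split=> //; [constructor|apply: gen_pop AP g].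
case: eqv => -> eqv; have [|w1 [w2 [-> g1 g2]]] := IH (inst gamma alpha ++ u1).
  by rewrite -catA eqv.
by exists w1, w2; split=> //; apply: gen_pop AP g1.
Qed.

Lemma gen_cons G x u w : gen G (x :: u) w ->
  exists w1 w2, [/\ w = w1 ++ w2, gen G [:: x] w1 & gen G u w2].
Proof. exact: (@gen_split G [:: x]). Qed.

Lemma gen_inr G a u w : gen G (inr a :: u) w -> exists2 w', w = a :: w' & gen G u w'.
Proof. by move=> g; inversion g; subst; exists w0. Qed.

(** Variables are rewritten independently of each other, so a step at any position can wait until it
    is leftmost. *)
Lemma in_lang_gen G w : in_lang G w <-> gen G [:: inl (start G, [::])] w.
Proof.
rewrite /in_lang; move: [:: _] => u; split=> [|g].
  move eqv: (map inr w) => v d; elim: d eqv => {u v} [u <- | u v v' st _ IH /IH g].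
    by elim: w => [|a w IH]; constructor.
  case: {IH} st g => [pre suf A gamma alpha AP|pre suf A B f gamma AP|pre suf A f gamma alpha AP].
  - by move=> /gen_split[w1 [w2 [-> g1 g2]]]; apply: gen_cat => //; apply: gen_plain AP g2.
  - by move=> /gen_split[w1 [w2 [-> g1 g2]]]; apply: gen_cat => //; apply: gen_push AP g2.
  by move=> /gen_split[w1 [w2 [-> g1 g2]]]; apply: gen_cat => //; apply: gen_pop AP g2.
suff main pre : derives G (map inr pre ++ u) (map inr (pre ++ w)) by apply: (main [::]).
elim: g pre => {u w}.
- by move=> pre; rewrite !cats0; constructor.
- move=> a u w _ IH pre; have := IH (rcons pre a).
  by rewrite map_rcons !cat_rcons.
- move=> A alpha gamma u w AP _ IH pre; apply: der_step (IH pre).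
  exact: st_plain.
- move=> A B f gamma u w AP _ IH pre; apply: der_step (IH pre).
  exact: st_push.
move=> A f alpha gamma u w AP _ IH pre; apply: der_step (IH pre).
exact: st_pop.
Qed.

(** * The grammar of a counter machine *)

Inductive act := Inc | Dec | Zero.

Inductive op := Bot | Round | Act of act & nat.

Definition op_index o :=
  match o with
  | Bot => 0%N
  | Round => 1%N
  | Act Inc i => (3 * i + 2)%N
  | Act Dec i => (3 * i + 3)%N
  | Act Zero i => (3 * i + 4)%N
  end.

Lemma op_index_inj : injective op_index.
Proof.
move=> [||a i] [||a' i'] //=; rewrite ?(f_equal2_mult) //.
- by case: a'; lia.
- by case: a'; lia.
- by case: a; lia.
- by case: a; lia.
by case: a; case: a' => e; (try lia); congr Act; lia.
Qed.

(* [RV], [RB], [RU] are v, b, u above; [RN i] is the opposite of counter [i], the only sign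
   that is ever needed. *)
Inductive reg := RV | RB | RU | RN of nat.

(** Residues modulo 3 separate the variables: multiples of 3 are control states, residue 1 holds the
    counters, residue 2 the fixed variables, where 11 and 14 are left for output and start. *)
Definition reg_var r :=
  match r with RV => 2%N | RB => 5%N | RU => 8%N | RN i => (3 * i + 1)%N end.

Lemma reg_var_inj : injective reg_var.
Proof. by move=> [|||i] [|||j] //=; try lia; move=> e; congr RN; lia. Qed.

(** Under the morphism, concatenation adds register values, the letters 0 and 1 contribute 1 and -1,
    and a register followed by the letter 2 becomes a factor of v. An empty right-hand side resets
    the register. The summand [RN i] in [RU] is the loss caused by a dishonest zero test. *)
Definition reg_rhs r o : seq (reg + nat) :=
  match r, o with
  | RV, Bot => [::]
  | RV, Round => [:: inl RV]
  | RV, Act Dec i => [:: inl RV; inl RB; inr 2%N; inl (RN i); inr 2%N]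
  | RV, Act _ i => [:: inl RV; inl RB; inr 2%N]
  | RB, Bot => [::]
  | RB, Round => [:: inl RU; inr 0%N]
  | RB, Act _ _ => [:: inl RB; inr 1%N]
  | RU, Act Zero i => [:: inl RU; inr 0%N; inl (RN i)]
  | RU, Act _ _ => [:: inl RU; inr 0%N]
  | RU, _ => [::]
  | RN j, Act a i =>
      if i == j then
        match a with
        | Inc => [:: inl (RN j); inr 1%N]
        | Dec => [:: inl (RN j); inr 0%N]
        | Zero => [::]
        end
      else [:: inl (RN j)]
  | RN j, _ => [::]
  end.

Definition reg_sym (x : reg + nat) : symbol :=
  match x with inl r => inl (reg_var r) | inr a => inr a end.

Definition regs k := [:: RV, RB, RU & map RN (iota 0 k)].
Definition ops k := [:: Bot, Round &
  flatten [seq [:: Act Inc i; Act Dec i; Act Zero i] | i <- iota 0 k]].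

Definition reg_lt k r := if r is RN i then (i < k)%N else true.
Definition op_lt k o := if o is Act _ i then (i < k)%N else true.

Lemma In_regs k r : reg_lt k r -> List.In r (regs k).
Proof.
case: r => [|||i] /=; try tauto; move=> lti; do 3!right.
by apply/In_map; exists i => //; apply/In_mem; rewrite mem_iota.
Qed.

Lemma In_ops k o : op_lt k o -> List.In o (ops k).
Proof.
case: o => [||a i] /=; try tauto; move=> lti; do 2!right.
apply/In_flatten_map; exists i; first by apply/In_mem; rewrite mem_iota.
by case: a => /=; tauto.
Qed.

Definition reg_rules k : seq production :=
  flatten [seq [seq PPop (reg_var r) (op_index o) (map reg_sym (reg_rhs r o)) | o <- ops k]
          | r <- regs k].

Definition transition := (nat * nat * (act * nat))%type.

(** The second rule allows a round to be closed in any state reached by a transition; state 0 has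
    its own such rule in [base_rules]. *)
Definition transition_rules (T : seq transition) : seq production :=
  flatten [seq [:: PPush (3 * t.1.1) (3 * t.1.2) (op_index (Act t.2.1 t.2.2));
                   PPush (3 * t.1.2) 0 (op_index Round)] | t <- T].

(** Variable 14 is the start, and in control state 0 the stack may be handed to variable 11, which
    emits scaling letters 5 and then the output. Only the number [k] of registers depends on the
    machine. *)
Definition base_rules k : seq production :=
  [:: PPush 14 0 (op_index Bot); PPush 0 0 (op_index Round);
      PPlain 0 [:: inl 11%N]; PPlain 11 [:: inr 5%N; inl 11%N];
      PPlain 11 [:: inr 3%N; inl (reg_var RV); inl (reg_var RB); inr 4%N]] ++ reg_rules k.

Definition grammar (T : seq transition) k : igrammar :=
  IGrammar 14 (transition_rules T ++ base_rules k).

Fixpoint reg_word (h : seq op) (r : reg) : seq nat :=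
  if h is o :: h' then
    flatten [seq match x with inl r' => reg_word h' r' | inr a => [:: a] end | x <- reg_rhs r o]
  else [::].

(** The stacks, latest operation first, that can be built on the way to a control state. Counter
    values are not consulted here. *)
Inductive control (T : seq transition) : nat -> seq op -> Prop :=
| control_bot : control T 0 [:: Bot]
| control_act A B a i h :
    List.In (A, B, (a, i)) T -> control T A h -> control T B (Act a i :: h)
| control_round A h : control T A h -> control T 0 (Round :: h).

Definition reg_inst (h : seq op) (x : reg + nat) : sitem :=
  match x with inl r => inl (reg_var r, map op_index h) | inr a => inr a end.

Lemma inst_reg h s : inst (map op_index h) (map reg_sym s) = map (reg_inst h) s.
Proof. by rewrite /inst -map_comp; apply: eq_map => -[]. Qed.

Section GrammarSemantics.

Variables (T : seq transition) (k : nat).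
Let G := grammar T k.

(** An overapproximation of the rules, without bounds on registers or states, that suffices for
    inversions. *)
Variant rule_spec : production -> Prop :=
| spec_act A B a i : List.In (A, B, (a, i)) T ->
    rule_spec (PPush (3 * A) (3 * B) (op_index (Act a i)))
| spec_round A : rule_spec (PPush (3 * A) 0 (op_index Round))
| spec_start : rule_spec (PPush 14 0 (op_index Bot))
| spec_observe : rule_spec (PPlain 0 [:: inl 11%N])
| spec_scale : rule_spec (PPlain 11 [:: inr 5%N; inl 11%N])
| spec_final : rule_spec (PPlain 11
    [:: inr 3%N; inl (reg_var RV); inl (reg_var RB); inr 4%N])
| spec_reg r o : rule_spec (PPop (reg_var r) (op_index o) (map reg_sym (reg_rhs r o))).

Lemma rule_specP p : List.In p (prods G) -> rule_spec p.
Proof.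
rewrite In_cat => -[|].
  by case/In_flatten_map=> -[[A B] [a i]] tT [|[|[]]] <-; constructor.
rewrite In_cat => -[|].
  case=> [|[|[|[|[|[]]]]]] <-; try by constructor.
  exact: (spec_round 0).
by case/In_flatten_map=> r _ /In_map[o _ ->]; constructor.
Qed.

Lemma gen_reg_inv r gamma w : gen G [:: inl (reg_var r, gamma)] w ->
  exists o gamma', gamma = op_index o :: gamma' /\
    gen G (inst gamma' (map reg_sym (reg_rhs r o))) w.
Proof.
move=> g; inversion g as [| |A al ga u w' AP g' | A B f ga u w' AP g' | A f al ga u w' AP g'];
  subst; have := rule_specP AP => sp; inversion sp as [A1 B1 a i tT E|A1 E|E|E|E|E|r1 o E];
  try by case: r {g AP g' sp} E => //= *; lia.
have rE : r1 = r by apply: reg_var_inj.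
by subst; exists o, ga; rewrite cats0 in g'.
Qed.

(** For each register and each top index there is only one right-hand side, so a stack determines
    the word. *)
Lemma gen_reg h r w : gen G [:: inl (reg_var r, map op_index h)] w -> w = reg_word h r.
Proof.
elim: h r w => [|o h IH] r w /gen_reg_inv [o' [gamma' [hE g]]] //.
case: hE => /op_index_inj oE gE; subst; move: g; rewrite inst_reg /=.
elim: (reg_rhs r o') w => [|[r'|a] s IHs] w /= g; first by inversion g.
  by have [w1 [w2 [-> /IH -> /IHs ->]]] := gen_cons g.
by have [w' -> /IHs ->] := gen_inr g.
Qed.

Lemma reg_rhs_lt r o : reg_lt k r -> op_lt k o ->
  all (fun x => if x is inl r' then reg_lt k r' else true) (reg_rhs r o).
Proof.
case: r o => [|||j] [||[] i] //= ltj lti; rewrite ?lti //.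
all: by case: eqP => //= _; rewrite ltj.
Qed.

Hypothesis T_lt : forall A B a i, List.In (A, B, (a, i)) T -> i < k.

Lemma reg_gen A h r : control T A h -> reg_lt k r ->
  gen G [:: inl (reg_var r, map op_index h)] (reg_word h r).
Proof.
have popP o h1 r1 : op_lt k o -> reg_lt k r1 ->
  (forall r', reg_lt k r' -> o <> Bot -> gen G [:: inl (reg_var r', map op_index h1)] (reg_word h1 r')) ->
  gen G [:: inl (reg_var r1, map op_index (o :: h1))] (reg_word (o :: h1) r1).
  move=> ltO ltr IH.
  apply: (gen_pop (alpha := map reg_sym (reg_rhs r1 o))).
    rewrite In_cat; right; rewrite In_cat; right.
    apply/In_flatten_map; exists r1; first exact: In_regs.
    by apply/In_map; exists o => //; apply: In_ops.
  rewrite cats0 inst_reg /=.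
  have [-> | oN] : o = Bot \/ o <> Bot by case: o {ltO IH} => [||a i]; [left|right|right].
    by case: r1 ltr => *; constructor.
  elim: (reg_rhs r1 o) (reg_rhs_lt ltr ltO) => [|[r'|a] s IHs] /=; first by constructor.
    move=> /andP[ltr' lts]; apply: (gen_cat (u1 := [:: _])); last exact: IHs.
    exact: IH.
  by move=> lts; constructor; apply: IHs.
move=> c; elim: c r => [|A1 B a i h1 tT c IH|A1 h1 c IH] r ltr; apply: popP => //.
- by rewrite /= (T_lt tT).
- by move=> r' ltr' _; apply: IH.
by move=> r' ltr' _; apply: IH.
Qed.

Definition output_word m h :=
  nseq m 5%N ++ 3%N :: reg_word h RV ++ reg_word h RB ++ [:: 4%N].

Lemma gen_observe h w : gen G [:: inl (11%N, map op_index h)] w ->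
  exists m, w = output_word m h.
Proof.
elim: w => [|x w IH] g;
  inversion g as [| |A al ga u w' AP g' | A B f ga u w' AP g' | A f al ga u w' AP g'];
  subst; have := rule_specP AP => sp;
  inversion sp as [A1 B1 a i tT E|A1 E|E|E|E|E|r1 o E]; subst; try lia;
  try by case: r1 E {sp AP g g'} => //=; lia.
- by have [w1 ? _] := gen_inr g'.
- by have [w1 ? _] := gen_inr g'.
- have [w1 [-> <-] /= /IH [m ->]] := gen_inr g'.
  by exists m.+1.
have [w1 [-> <-]] := gen_inr g'; rewrite -[X in gen G X _]/([:: _; _; _]).
move=> /gen_cons[u1 [u2 [-> /(@gen_reg h RV) -> /gen_cons[u3 [u4 [-> /(@gen_reg h RB) -> /gen_inr[v ->]]]]]]] g0.
by inversion g0; exists 0%N.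
Qed.

Lemma gen_control A h w : control T A h -> gen G [:: inl ((3 * A)%N, map op_index h)] w ->
  exists m h', control T 0 h' /\ w = output_word m h'.
Proof.
move eqx: [:: _] => x c g; elim: g A h c eqx => {x w} //.
- move=> A al ga u w AP g _ A0 h c [? ? ?]; subst; have := rule_specP AP => sp.
  inversion sp as [A1 B1 a i tT E|A1 E|E|E|E|E|r1 o E]; subst; try lia.
  have [m ->] := gen_observe g; exists m, h; split=> //.
  by have -> : 0 = A0 by lia.
- move=> A B f ga u w AP _ IH A0 h c [? ? ?]; subst; have := rule_specP AP => sp.
  inversion sp as [A1 B1 a i tT E|A1 E|E|E|E|E|r1 o E]; subst; try lia.
    apply: (IH B1 (Act a i :: h)) => //; apply: control_act tT _.
    by have -> : A1 = A0 by lia.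
  by apply: (IH 0 (Round :: h)) => //; apply: control_round c.
move=> A f al ga u w AP _ _ A0 h c [? ? ?]; subst; have := rule_specP AP => sp.
by inversion sp as [| | | | | |r o E1]; case: (r) E1 => /=; lia.
Qed.

Lemma lang_control w : in_lang G w -> exists m h, control T 0 h /\ w = output_word m h.
Proof.
move=> /in_lang_gen g.
inversion g as [| |A al ga u w' AP g' | A B f ga u w' AP g' | ];
  subst; have := rule_specP AP => sp;
  inversion sp as [A1 B1 a i tT E|A1 E|E|E|E|E|r1 o E]; subst; try (simpl in *; lia).
exact: gen_control (control_bot T) g'.
Qed.

Lemma control_target A h : control T A h ->
  A = 0 \/ exists B x, List.In (B, A, x) T.
Proof. by case=> [|A1 B a i h1 tT _|]; [left|right; exists A1, (a, i)|left]. Qed.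

(** The pushes that built [h] are prepended one by one, the last one first, back to the start
    variable. Undoing a [Round] uses that the state before it is 0 or the target of a transition. *)
Lemma control_gen A h w : control T A h -> gen G [:: inl ((3 * A)%N, map op_index h)] w ->
  in_lang G w.
Proof.
move=> c; elim: c => [|A1 B a i h1 tT c IH|A1 h1 c IH] g.
- apply/in_lang_gen; apply: gen_push g.
  by rewrite In_cat; right; left.
- apply: IH; apply: gen_push g.
  rewrite In_cat; left; apply/In_flatten_map; exists (A1, B, (a, i)) => //.
  by left.
apply: IH; apply: gen_push g; rewrite In_cat.
have [->|[B [[a i] tT]]] := control_target c; first by right; right; left.
left; apply/In_flatten_map; exists (B, A1, (a, i)) => //.
by right; left.
Qed.

Lemma control_lang m h : control T 0 h -> in_lang G (output_word m h).
Proof.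
move=> c; apply: control_gen (c) _.
apply: (@gen_plain G 0 [:: inl 11%N]); first by rewrite In_cat; right; right; right; left.
elim: m => [|m IH].
  apply: (@gen_plain G 11 [:: inr 3%N; inl (reg_var RV); inl (reg_var RB); inr 4%N]).
    by rewrite In_cat; right; do 4!right; left.
  constructor; apply: (gen_cat (u1 := [:: _])); first exact: reg_gen c _.
  apply: (gen_cat (u1 := [:: _])); first exact: reg_gen c _.
  by do 2!constructor.
apply: (@gen_plain G 11 [:: inr 5%N; inl 11%N]).
  by rewrite In_cat; right; do 3!right; left.
by constructor.
Qed.

Lemma grammar_terminals : terminals_below G 6.
Proof.
have regP r o : all (symbol_terminal_lt 6) (map reg_sym (reg_rhs r o)).
  by case: r o => [|||j] [||[] i] //=; case: eqP.
by move=> A al f [] /rule_specP sp; inversion sp => //; apply: regP.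
Qed.

End GrammarSemantics.

(** * Register values and honest runs *)

Fixpoint reg_val (h : seq op) (r : reg) : rat :=
  if h is o :: h' then
    match r, o with
    | RV, Bot => 1
    | RV, Round => reg_val h' RV
    | RV, Act Dec i => reg_val h' RV * reg_val h' RB * reg_val h' (RN i)
    | RV, Act _ i => reg_val h' RV * reg_val h' RB
    | RB, Bot => 0
    | RB, Round => reg_val h' RU + 1
    | RB, Act _ _ => reg_val h' RB - 1
    | RU, Act Zero i => reg_val h' RU + 1 + reg_val h' (RN i)
    | RU, Act _ _ => reg_val h' RU + 1
    | RU, _ => 0
    | RN j, Act a i =>
        if i == j then
          match a with
          | Inc => reg_val h' (RN j) - 1
          | Dec => reg_val h' (RN j) + 1
          | Zero => 0
          end
        else reg_val h' (RN j)
    | RN j, _ => 0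
    end%R
  else (if r is RV then 1 else 0)%R.

Definition upd (c : nat -> nat) i v := fun j => if j == i then v else c j.
Definition act_ok a n := match a with Inc => true | Dec => n != 0 | Zero => n == 0 end.
Definition act_apply a n := match a with Inc => n.+1 | Dec => n.-1 | Zero => 0 end.

Inductive honest (T : seq transition) : nat -> nat -> (nat -> nat) -> Prop :=
| honest0 : honest T 0 0 (fun=> 0)
| honestS n A c B a i :
    List.In (A, B, (a, i)) T -> honest T n A c -> act_ok a (c i) ->
    honest T n.+1 B (upd c i (act_apply a (c i))).

Lemma sum_upd k c i v : i < k ->
  \sum_(j < k) upd c i v j + c i = \sum_(j < k) c j + v.
Proof.
move=> lti; rewrite (bigD1 (Ordinal lti)) //= (bigD1 (Ordinal lti) (F := fun j => c j)) //=.
rewrite {1}/upd eqxx (eq_bigr (fun j : 'I_k => c j)); first by lia.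
by move=> j jN; rewrite /upd; case: eqP => // ji; case/eqP: jN; apply: val_inj.
Qed.

Section Runs.

Variables (T : seq transition) (k : nat).
Hypothesis T_lt : forall A B a i, List.In (A, B, (a, i)) T -> i < k.

(* [n] is the budget at the start of the current round; a dishonest zero test loses
   tokens, so that the budget is conserved only along honest runs. *)
Lemma control_inv t :
  (forall n A c, honest T n A c -> n <= t) ->
  forall A h, control T A h -> reg_val h RV != 0%R ->
  exists b u n c, [/\ reg_val h RB = b%:R%R, reg_val h RU = u%:R%R,
    (forall i, reg_val h (RN i) = - (c i)%:R)%R,
    (\sum_(i < k) c i <= u /\ b + u <= n /\ n <= t.+1)%N &
    b + u = n -> honest T u A c].
Proof.
move=> ht A h; elim=> {A h} [|A B a i h tT cP IH|A h cP IH] /= v_neq0.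
- exists 0%N, 0%N, 0%N, (fun=> 0%N); split=> //; first by rewrite big1.
  by move=> _; constructor.
- have : reg_val h RV != 0%R /\ reg_val h RB != 0%R.
    by case: a v_neq0 {tT}; rewrite !mulf_eq0 !negb_or => /andP[] // /andP[].
  case=> /IH[b [u [n [c [bE uE cE [sum_le [le_n le_t]] hon]]]]].
  rewrite bE pnatr_eq0 -lt0n => b_gt0.
  have b1E : (b%:R - 1 = (b.-1)%:R :> rat)%R by rewrite -[in LHS](prednK b_gt0) -natr1 addrK.
  have lti := T_lt tT.
  have ci_le : c i <= u.
    by apply: leq_trans sum_le; rewrite (bigD1 (Ordinal lti)) //= leq_addr.
  (* A decrement also multiplies v by the counter; only zero tests can be dishonest. *)
  have aok : a = Zero \/ act_ok a (c i).
    case: a v_neq0 {tT} => [|v_neq0|]; [by right| right | by left].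
    by move: v_neq0; rewrite /= cE !mulf_eq0 !negb_or oppr_eq0 pnatr_eq0 => /andP[].
  have sumE := sum_upd c (act_apply a (c i)) lti.
  (* The truncated subtraction is exact since [c i] is at most [u]; the bound on the sum of the
     counters is in the invariant for this purpose. *)
  exists b.-1, (if a is Zero then u.+1 - c i else u.+1)%N, n, (upd c i (act_apply a (c i))).
  split.
  + by rewrite -b1E.
  + rewrite uE; case: (a); rewrite ?natr1 // cE natrB ?natr1 //.
    by rewrite (leq_trans ci_le).
  + move=> j; rewrite /upd eq_sym; case: eqP => // ->; rewrite cE.
    case: a aok {v_neq0 tT sumE} => [_|[//|/= c_neq0]|_] /=.
    * by rewrite -natr1 opprD.
    * by rewrite -[in LHS](prednK (n := c i)) ?lt0n // -natr1 opprD addrNK.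
    * by rewrite oppr0.
  + move: sumE sum_le; move: (\sum_(j < k) upd c i (act_apply a (c i)) j) => S.
    move: (\sum_(j < k) c j) => S0 sumE sum_le.
    case: a aok sumE {v_neq0 tT} => [_|[//|/= c_neq0]|_] /= sumE.
    * by lia.
    * by move: c_neq0; rewrite -lt0n => c_gt0; lia.
    * by lia.
  case: a aok tT {v_neq0 sumE} => [_|[//|c_neq0]|_] tT E.
  + by apply: honestS tT _ _ => //; apply: hon; lia.
  + by apply: honestS tT _ _ => //; apply: hon; lia.
  (* A conserved budget leaves no room for a loss at this test. *)
  have c0 : c i = 0 by lia.
  rewrite c0 subn0; apply: (honestS (a := Zero)) tT _ _; last by rewrite /= c0.
  by apply: hon; lia.
have [b [u [n [c [bE uE cE [sum_le [le_n le_t]] hon]]]]] := IH v_neq0.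
exists u.+1, 0%N, u.+1, (fun=> 0%N); split=> //.
- by rewrite uE natr1.

- split; first by rewrite big1.
  split; first by rewrite addn0.
  (* If the closed round conserved its budget, it was an honest run of [u] steps, so [u <= t];
     otherwise [u < n <= t.+1]. *)
  have [eqn|neqn] := eqVneq (b + u) n; last by lia.
  by rewrite ltnS; apply: ht (hon eqn).
by move=> _; constructor.
Qed.

(** Induction on the budget: a round with budget [n] spent on an honest run of exactly [n] steps
    ends with u equal to [n], so the next one starts with [n.+1]. *)
Lemma control_full :
  (forall n, exists A c, honest T n A c) ->
  forall n, exists h, [/\ control T 0 h, reg_val h RV != 0%R & reg_val h RB = n%:R%R].
Proof.
move=> hon n.
suff: exists h, [/\ control T 0 h, reg_val h RV != 0%R, reg_val h RB = n%:R%R,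
    reg_val h RU = 0%R & forall i, reg_val h (RN i) = 0%R].
  by case=> h [? ? ? _ _]; exists h.
elim: n => [|n [h [cP vP bP uP nP]]].
  by exists [:: Bot]; split=> //; constructor.
have [A [c hA]] := hon n.
suff main m A' c' : honest T m A' c' -> m <= n ->
    exists h', [/\ control T A' h', reg_val h' RV != 0%R, reg_val h' RB = (n - m)%:R%R,
      reg_val h' RU = m%:R%R & forall i, reg_val h' (RN i) = - (c' i)%:R]%R.
  have [//|h' [cP' vP' _ uP' _]] := main _ _ _ hA.
  exists (Round :: h'); split=> //=; first exact: control_round cP'.
  by rewrite uP' natr1.
elim=> {m A' c'} [_|m A' c' B a i tT _ IH aok ltmn].
  by exists h; split=> //; rewrite bP subn0.
have [h' [cP' vP' bP' uP' nP']] := IH (ltnW ltmn).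
exists (Act a i :: h'); split.
- exact: control_act tT cP'.
- have b_neq0 : reg_val h' RB != 0%R by rewrite bP' pnatr_eq0 -lt0n subn_gt0.
  case: a aok {tT} => /= aok; rewrite !mulf_neq0 // nP' oppr_eq0 pnatr_eq0 //.
- by rewrite /= bP' -[in LHS](subnSK ltmn) -natr1 addrK.
- by case: a aok {tT} => /= aok; rewrite uP' ?natr1 // nP' (eqP aok) subr0.
move=> j; rewrite /upd /= eq_sym; case: eqP => // ->; rewrite nP'.
case: a aok {tT} => /= aok.
- by rewrite -natr1 opprD.
- by rewrite -[in LHS](prednK (n := c' i)) ?lt0n // -natr1 opprD addrNK.
by rewrite oppr0.
Qed.

End Runs.

(** * The matrices *)

Local Open Scope ring_scope.

Definition mx2 (a b c d : rat) : 'M[rat]_2 :=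
  \matrix_(i, j) if i == 0 then (if j == 0 then a else b) else (if j == 0 then c else d).

Lemma mx2M a b c d a' b' c' d' :
  mx2 a b c d *m mx2 a' b' c' d' =
  mx2 (a * a' + b * c') (a * b' + b * d') (c * a' + d * c') (c * b' + d * d').
Proof.
apply/matrixP=> i j; rewrite !mxE !big_ord_recl big_ord0 !mxE addr0.
by case: i => [[|[|//]] ?]; case: j => [[|[|//]] ?].
Qed.

Lemma mx2_1 : mx2 1 0 0 1 = 1%:M.
Proof. by apply/matrixP=> -[[|[|//]] ?] [[|[|//]] ?]; rewrite !mxE. Qed.

Lemma mx2_eq a b c d a' b' c' d' : a = a' -> b = b' -> c = c' -> d = d' ->
  mx2 a b c d = mx2 a' b' c' d'.
Proof. by move=> -> -> -> ->. Qed.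

(* Row vectors are acted upon from the right: the letters 0 and 1 shear [(1, x)] to
   [(1, x + 1)] and [(1, x - 1)], letter 2 turns [(1, x)] into [(x, 0)], letters 3 and 4
   delimit the computation so that the point [(v, v b)] lands on the all-ones matrix
   when [v = 0], and letter 5 makes the image a cone. *)
Definition letters : seq 'M[rat]_2 :=
  [:: mx2 1 1 0 1; mx2 1 (-1) 0 1; mx2 0 0 1 0; mx2 1 0 1 0; mx2 1 0 1 1; mx2 2 0 0 2].

Lemma phi_cat w1 w2 : phi letters (w1 ++ w2) = phi letters w1 *m phi letters w2.
Proof. by elim: w1 => [|a w IH] /=; rewrite ?mul1mx // IH mulmxA. Qed.

Lemma phi_cons a w : phi letters (a :: w) = nth 1%:M letters a *m phi letters w.
Proof. by []. Qed.

Lemma phi_nil : phi letters [::] = mx2 1 0 0 1.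
Proof. by rewrite mx2_1. Qed.

Lemma phi_reg h r :
  if r is RV then exists x y, phi letters (reg_word h RV) = mx2 (reg_val h RV) 0 x y
  else phi letters (reg_word h r) = mx2 1 (reg_val h r) 0 1.
Proof.
elim: h r => [|o h IH] r.
  by case: r => [|||j]; rewrite phi_nil //; exists 0, 1.
have [x [y V]] := IH RV; have B := IH RB; have U := IH RU.
have N i := IH (RN i); rewrite /= in B U N.
case: r => [|||j]; case: o => [||[] i] /=.
all: try case: (i == j) => /=.
all: rewrite ?(phi_cat, phi_cons) /= -?mx2_1 ?V ?B ?U ?N ?mx2M.
all: try (by eexists; eexists; apply: mx2_eq; try reflexivity; ring).
all: by apply: mx2_eq; ring.
Qed.

Definition point (v y : rat) : 'M[rat]_2 := mx2 (v + y) y (v + y) y.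

Lemma phi_output m h :
  phi letters (output_word m h) =
  point (2 ^+ m * reg_val h RV) (2 ^+ m * reg_val h RV * reg_val h RB).
Proof.
have [x [y V]] := phi_reg h RV; have B := phi_reg h RB; rewrite /= in B.
rewrite /output_word /point; elim: m => [|m IH] /=.
  rewrite ?(phi_cat, phi_cons, phi_nil) /= V B !mx2M.
  by apply: mx2_eq; ring.
by rewrite IH mx2M; apply: mx2_eq; rewrite exprS; ring.
Qed.

Lemma point_ones : point 0 1 = const_mx 1.
Proof. by apply/matrixP=> -[[|[|//]] ?] [[|[|//]] ?]; rewrite !mxE /= ?add0r. Qed.

Lemma mxpt_ones : mxpt (const_mx 1 : 'M[rat]_2) = fun=> 1.
Proof. by apply: functional_extensionality => i; rewrite /mxpt; case/mxvec_indexP: i => i j; rewrite mxvecE mxE. Qed.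

(** * Polynomials vanishing on the image *)

Definition image (G : igrammar) : 'M[rat]_2 -> Prop :=
  fun A => exists w, in_lang G w /\ A = phi letters w.

Lemma mxpt_mx2 a b c d :
  mxpt (mx2 a b c d) (mxvec_index 0 0) = a /\ mxpt (mx2 a b c d) (mxvec_index 0 1) = b.
Proof. by rewrite /mxpt !mxvecE !mxE. Qed.

(** The polynomial is the product of the equations y = b v for b up to [t.+1], written in the
    entries X = v + y and Y = y. Each factor is 1 at the all-ones matrix. *)
Lemma image_bounded T k t :
  (forall A B a i, List.In (A, B, (a, i)) T -> (i < k)%N) ->
  (forall n A c, honest T n A c -> (n <= t)%N) ->
  exists2 p : {mpoly rat[2 * 2]}, vanishing_ideal (image (grammar T k)) p & p.@[fun=> 1] != 0.
Proof.
move=> T_lt ht.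
pose X : {mpoly rat[2 * 2]} := 'X_(mxvec_index 0 0); pose Y : {mpoly rat[2 * 2]} := 'X_(mxvec_index 0 1).
pose p := \prod_(b < t.+2) (Y - (b%:R)%:MP * (X - Y)).
have pE A : p.@[A] = \prod_(b < t.+2)
    (A (mxvec_index 0 1) - b%:R * (A (mxvec_index 0 0) - A (mxvec_index 0 1))).
  rewrite /p rmorph_prod; apply: eq_bigr => b _.
  by rewrite /= mevalB mevalM mevalB mevalC !mevalXU.
exists p; last first.
  by rewrite pE big1 ?oner_eq0 // => b _; rewrite subrr mulr0 subr0.
move=> A [w [/(lang_control (k := k)) [m [h [cP ->]]] ->]].
rewrite phi_output pE /point.
set a := (X in mxpt X).
have [-> ->] : mxpt a (mxvec_index 0 0) = _ /\ mxpt a (mxvec_index 0 1) = _ := mxpt_mx2 _ _ _ _.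
have [v0|v_neq0] := eqVneq (reg_val h RV) 0.
  (* For v = 0 the point is the origin, where the factor for b = 0 vanishes. *)
  by rewrite v0 big_ord_recl /= mul0r subr0 mulr0 mul0r mul0r.
have [b [u [n [c [bE uE cE [sum_le [le_n le_t]] hon]]]]] := control_inv T_lt ht cP v_neq0.
have ltb : (b < t.+2)%N by lia.
rewrite (bigD1 (Ordinal ltb)) //= bE addrK.
by rewrite [X in X - _]mulrC subrr mul0r.
Qed.

Lemma meval_line n (p : {mpoly rat[n]}) (u v : 'I_n -> rat) :
  exists q : {poly rat}, forall t, q.[t] = p.@[fun i => u i + t * v i].
Proof.
exists (mmap polyC (fun i => (u i)%:P + 'X * (v i)%:P) p) => t.
rewrite /meval /mmap horner_sum; apply: eq_bigr => m _.
rewrite hornerM hornerC /mmap1 horner_prod; congr (_ * _); apply: eq_bigr => i _.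
by rewrite horner_exp hornerD hornerM hornerX !hornerC.
Qed.

Lemma poly_many_roots (q : {poly rat}) (g : nat -> rat) :
  injective g -> (forall m, q.[g m] = 0) -> q = 0.
Proof.
move=> g_inj qg; apply/eqP/negPn/negP => q_neq0.
suff: (size [seq g i | i <- iota 0 (size q)] < size q)%N.
  by rewrite size_map size_iota ltnn.
apply: max_poly_roots => //.
  by apply/allP=> x /mapP[i _ ->]; rewrite /root qg.
by rewrite map_inj_uniq // iota_uniq.
Qed.

(** Scaling by powers of 2 gives infinitely many zeros on each line y = n v, so [p] vanishes on all
    of it. The lines with n > 0 meet y = 1 in the infinitely many points (1/n, 1), so [p] vanishes
    on y = 1, hence at (0, 1). *)
Lemma image_unbounded T k (p : {mpoly rat[2 * 2]}) :
  (forall A B a i, List.In (A, B, (a, i)) T -> (i < k)%N) ->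
  (forall n, exists A c, honest T n A c) ->
  vanishing_ideal (image (grammar T k)) p -> p.@[fun=> 1] = 0.
Proof.
move=> T_lt hon pP.
have pointE v y : mxpt (point v y) = fun i => v * mxpt (point 1 0) i + y * mxpt (point 0 1) i.
  apply: functional_extensionality => i; case/mxvec_indexP: i => i j; rewrite /mxpt !mxvecE.
  by case: i => [[|[|//]] ?]; case: j => [[|[|//]] ?]; rewrite !mxE /=; ring.
have ray n l : p.@[mxpt (point l (l * n%:R))] = 0.
  have [h [cP v_neq0 bE]] := control_full hon n.
  have [q qE] := meval_line p (fun=> 0) (mxpt (point 1 n%:R)).
  have scaleE l' : mxpt (point l' (l' * n%:R)) = fun i => 0 + l' * mxpt (point 1 n%:R) i.
    apply: functional_extensionality => i; rewrite (pointE 1 n%:R) (pointE l' _) add0r mul1r.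
    by rewrite mulrDr mulrA.
  suff q0 : q = 0 by rewrite scaleE -qE q0 horner0.
  apply: (poly_many_roots (g := fun m => 2 ^+ m * reg_val h RV)) => [m1 m2 /(mulIf v_neq0)|m].
    by move/eqP; rewrite -!natrX eqr_nat eqn_exp2l // => /eqP.
  rewrite qE -scaleE -bE -phi_output; apply: pP; exists (output_word m h); split=> //.
  exact: control_lang cP.
rewrite -mxpt_ones -point_ones.
have [q qE] := meval_line p (mxpt (point 0 1)) (mxpt (point 1 0)).
have lineE t : mxpt (point t 1) = fun i => mxpt (point 0 1) i + t * mxpt (point 1 0) i.
  by apply: functional_extensionality => i; rewrite (pointE t 1) mul1r addrC.
suff q0 : q = 0 by rewrite lineE -qE q0 horner0.
apply: (poly_many_roots (g := fun m => (m.+1%:R)^-1)) => [m1 m2 /invr_inj/eqP|m].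
  by rewrite eqr_nat eqSS => /eqP.
rewrite qE -lineE; have := ray m.+1 (m.+1%:R)^-1.
by rewrite mulVf // pnatr_eq0.
Qed.

Local Close Scope ring_scope.

(** * From recursive functions to counter machines *)

(** A program doubles as a machine state: what is left to execute. [PLoop i b r] repeats a decrement
    of [i] followed by [b] until [i] is zero, then goes on with [r]; so every edge is one counter
    operation. *)
Inductive prog := Halt | PInc of nat & prog | PLoop of nat & prog & prog.

Fixpoint papp p q :=
  match p with
  | Halt => q
  | PInc i r => PInc i (papp r q)
  | PLoop i b r => PLoop i b (papp r q)
  end.

Lemma pappA p q r : papp (papp p q) r = papp p (papp q r).
Proof. by elim: p => //= [i p ->|i b _ p ->]. Qed.

Lemma papp_halt p : papp p Halt = p.
Proof. by elim: p => //= [i p ->|i b _ p ->]. Qed.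

Inductive edge : prog -> act -> nat -> prog -> Prop :=
| edge_inc i r : edge (PInc i r) Inc i r
| edge_exit i b r : edge (PLoop i b r) Zero i r
| edge_enter i b r : edge (PLoop i b r) Dec i (papp b (PLoop i b r)).

Inductive exec p s : nat -> prog -> (nat -> nat) -> Prop :=
| exec0 : exec p s 0 p s
| execS n q t a i r :
    exec p s n q t -> edge q a i r -> act_ok a (t i) ->
    exec p s n.+1 r (upd t i (act_apply a (t i))).

Lemma exec_trans p s m q t n r u :
  exec p s m q t -> exec q t n r u -> exec p s (m + n) r u.
Proof.
move=> e1; elim=> {n r u} [|n r u a i r' _ IH ed ok]; first by rewrite addn0.
by rewrite addnS; apply: execS IH ed ok.
Qed.

Lemma exec_step p s a i q t :
  edge p a i q -> act_ok a (s i) -> upd s i (act_apply a (s i)) = t -> exec p s 1 q t.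
Proof. by move=> ed ok <-; apply: execS ed ok; constructor. Qed.

Lemma exec_det p s n q t q' t' : exec p s n q t -> exec p s n q' t' -> q = q' /\ t = t'.
Proof.
move=> e; elim: e q' t' => {n q t} [|n q t a i r _ IH ed ok] q' t' e'.
  by inversion e'.
inversion e' as [|n' q1 t1 a1 i1 r1 e1 ed1 ok1 E1 E2 E3]; subst.
have [? ?] := IH _ _ e1; subst; split.
  inversion ed; subst; inversion ed1; subst => //; move: ok ok1 => /=; by [|move=> -> | move=> /negbTE ->].
by inversion ed; subst; inversion ed1; subst => //; move: ok ok1 => /=; [move=> -> | move=> /negbTE ->].
Qed.

Lemma exec_prefix p s n q t m : exec p s n q t -> m <= n -> exists q' t', exec p s m q' t'.
Proof.
move=> e; elim: e m => {n q t} [|n q t a i r e IH ed ok] m.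
  by rewrite leqn0 => /eqP ->; exists p, s; constructor.
rewrite leq_eqVlt => /predU1P[->|]; last exact: IH.
by do 2!eexists; apply: execS e ed ok.
Qed.

(** By determinism a longer execution would have to leave [Halt], which has no outgoing edge. *)
Lemma exec_halt p s n t m q u : exec p s n Halt t -> exec p s m q u -> m <= n.
Proof.
move=> eh e; rewrite leqNgt; apply/negP => ltnm.
have [q' [t' e']] := exec_prefix e ltnm.
inversion e' as [|n' q1 t1 a1 i1 r1 e1 ed1]; subst.
have [qE _] := exec_det eh e1; rewrite -qE in ed1; inversion ed1.
Qed.

(** Quantifying over the continuation [K] lets runs be concatenated and used as loop bodies. *)
Definition runs p s t := forall K, exists n, exec (papp p K) s n K t.

Lemma runs_halt s : runs Halt s s.
Proof. by move=> K; exists 0; constructor. Qed.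

Lemma runs_app p q s t u : runs p s t -> runs q t u -> runs (papp p q) s u.
Proof.
move=> rp rq K; rewrite pappA.
have [m e1] := rp (papp q K); have [n e2] := rq K.
by exists (m + n); apply: exec_trans e1 e2.
Qed.

Lemma runs_inc i s : runs (PInc i Halt) s (upd s i (s i).+1).
Proof. by move=> K; exists 1; apply: exec_step (edge_inc i K) _ _. Qed.

Ltac upd_ext :=
  let j := fresh "j" in
  apply: functional_extensionality => j; rewrite /upd /=;
  repeat (case: eqP => //= ?; try subst j => //=); try congruence; try lia.

Lemma runs_loop i b (st : nat -> nat -> nat) n :
  (forall k, k < n -> st k i != 0 /\ runs b (upd (st k) i (st k i).-1) (st k.+1)) ->
  st n i = 0 -> runs (PLoop i b Halt) (st 0) (st n).
Proof.
move=> stP stn K /=.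
suff: forall m, m <= n -> exists l, exec (PLoop i b K) (st (n - m)) l K (st n).
  by move/(_ n (leqnn n)); rewrite subnn.
elim=> [_|m IH ltmn].
  rewrite subn0; exists 1; apply: exec_step (edge_exit i b K) _ _; first by rewrite /= stn.
  by upd_ext.
have [l2 e2] := IH (ltnW ltmn).
have [|neq0 rb] := stP (n - m.+1); first lia.
have [l1 e1] := rb (PLoop i b K).
exists (1 + l1 + l2); apply: exec_trans e2; apply: exec_trans; last first.
  by rewrite -(subnSK ltmn); exact: e1.
exact: exec_step (edge_enter i b K) neq0 _.
Qed.

(** * Basic register programs *)

Definition clear i := PLoop i Halt Halt.
Definition move_reg i j := PLoop i (PInc j Halt) Halt.
(** The first loop consumes [i], so its value is also collected in the scratch register [t] and
    moved back. *)
Definition copy_reg i j t := papp (PLoop i (PInc j (PInc t Halt)) Halt) (move_reg t i).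

Lemma runs_clear i s : runs (clear i) s (upd s i 0).
Proof.
pose st k := upd s i (s i - k).
have s0 : st 0 = s by rewrite /st; upd_ext.
have <- : st (s i) = upd s i 0 by rewrite /st; upd_ext.
rewrite -[X in runs _ X _]s0; apply: (@runs_loop i Halt st (s i)); last by rewrite /st /upd eqxx subnn.
move=> k ltk; split; first by rewrite /st /upd eqxx; lia.
rewrite (_ : upd _ _ _ = st k.+1); first exact: runs_halt.
by rewrite /st; upd_ext.
Qed.

Lemma runs_move i j s : i != j ->
  runs (move_reg i j) s (upd (upd s j (s j + s i)) i 0).
Proof.
move=> /eqP neq; pose st k := upd (upd s j (s j + k)) i (s i - k).
have s0 : st 0 = s by rewrite /st; upd_ext.
have <- : st (s i) = upd (upd s j (s j + s i)) i 0 by rewrite /st; upd_ext.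
rewrite -[X in runs _ X _]s0; apply: (@runs_loop i _ st (s i)); last by rewrite /st /upd eqxx subnn.
move=> k ltk; split; first by rewrite /st /upd eqxx; lia.
set t := upd _ _ _; rewrite (_ : st k.+1 = upd t j (t j).+1); first exact: runs_inc.
by rewrite /t /st; upd_ext.
Qed.

Lemma runs_copy i j t s : i != j -> i != t -> j != t -> s t = 0 ->
  runs (copy_reg i j t) s (upd s j (s j + s i)).
Proof.
move=> /eqP ij /eqP it /eqP jt t0.
pose st k := upd (upd (upd s j (s j + k)) t k) i (s i - k).
apply: (@runs_app _ _ _ (st (s i))).
  have s0 : st 0 = s by rewrite /st; upd_ext.
  rewrite -[X in runs _ X _]s0; apply: (@runs_loop i _ st (s i)); last by rewrite /st /upd eqxx subnn.
  move=> k ltk; split; first by rewrite /st /upd eqxx; lia.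
  set u := upd _ _ _; apply: (@runs_app (PInc j Halt) (PInc t Halt) _ (upd u j (u j).+1)).
    exact: runs_inc.
  set v := upd _ _ _; rewrite (_ : st k.+1 = upd v t (v t).+1); first exact: runs_inc.
  by rewrite /v /u /st; upd_ext.
have := @runs_move t i (st (s i)); rewrite eq_sym; move/eqP: (it) => -> /(_ isT).
by congr runs; rewrite /st; upd_ext.
Qed.

Fixpoint clears js := if js is j :: js' then papp (clear j) (clears js') else Halt.

Lemma runs_clears js s : runs (clears js) s (fun r => if r \in js then 0 else s r).
Proof.
elim: js s => [|j js IH] s; first exact: runs_halt.
rewrite (_ : (fun r => _) = (fun r => if r \in js then 0 else upd s j 0 r)).
  by apply: runs_app (IH _); apply: runs_clear.
apply: functional_extensionality => r; rewrite inE /upd.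
by case: eqP; case: (r \in js).
Qed.

(** * Compilation of recursive functions *)

Section Compiles.
Variables (comp : code -> seq nat -> nat -> nat -> prog) (args : seq nat) (fr : nat).

Fixpoint compiles gs j :=
  if gs is g :: gs' then papp (comp g args j fr) (compiles gs' j.+1) else Halt.

End Compiles.

(* [compile c args out fr] puts in register [out] the value of [c] at the contents of the
   registers [args], leaving every other register unchanged; the registers from [fr] on are
   scratch space. *)
Fixpoint compile (c : code) (args : seq nat) (out fr : nat) : prog :=
  match c with
  | CZero => Halt
  | CSucc => papp (if args is a :: _ then copy_reg a out fr else Halt) (PInc out Halt)
  | CProj i => if i < size args then copy_reg (nth 0 args i) out fr else Halt
  | CComp f gs =>
      papp (compiles compile args (fr + size gs) gs fr)
        (papp (compile f (iota fr (size gs)) out (fr + size gs)) (clears (iota fr (size gs))))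
  | CPrec f g =>
      if args is a :: args' then
        papp (compile f args' fr.+1 (fr + 4)) (papp (copy_reg a (fr + 3) (fr + 4))
          (papp (PLoop (fr + 3)
            (papp (compile g [:: fr, fr.+1 & args'] fr.+2 (fr + 4))
               (papp (clear fr.+1) (papp (move_reg fr.+2 fr.+1) (PInc fr Halt)))) Halt)
            (papp (clear fr) (move_reg fr.+1 out))))
      else Halt
  | CMu f =>
      papp (PInc fr.+2 Halt)
        (papp (PLoop fr.+2 (papp (compile f (fr :: args) fr.+1 (fr + 3))
                (PLoop fr.+1 (papp (clear fr.+1) (PInc fr (PInc fr.+2 Halt))) Halt)) Halt)
              (move_reg fr out))
  end.

Arguments papp : simpl never.

(** Copying adds to its target, so [out] and the scratch registers must start at zero; equality of
    the whole contents returns the scratch space clean for the next call. *)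
Definition compiled c := forall args out fr s y,
  all (fun a => a < fr) args -> out < fr -> out \notin args ->
  s out = 0 -> (forall r, fr <= r -> s r = 0) -> eval c (map s args) y ->
  runs (compile c args out fr) s (upd s out y).

(** The generated induction principle has no hypotheses for the codes inside the list of [CComp]. *)
Lemma code_ind_nested (P : code -> Prop) :
  P CZero -> P CSucc -> (forall i, P (CProj i)) ->
  (forall f gs, P f -> foldr (fun g A => P g /\ A) True gs -> P (CComp f gs)) ->
  (forall f g, P f -> P g -> P (CPrec f g)) -> (forall f, P f -> P (CMu f)) ->
  forall c, P c.
Proof.
move=> P0 PS Pproj Pcomp Pprec Pmu; fix IH 1 => -[||i|f gs|f g|f].
- exact: P0.
- exact: PS.
- exact: Pproj.
- apply: Pcomp; first exact: IH.
  elim: gs => [|g gs IHgs]; first exact: I.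
  by split; first exact: IH.
- by apply: Pprec; apply: IH.
by apply: Pmu; apply: IH.
Qed.

Lemma map_upd s i v args : i \notin args -> map (upd s i v) args = map s args.
Proof.
move=> ni; apply/eq_in_map => a ain; rewrite /upd; case: eqP => // ai.
by rewrite -ai ain in ni.
Qed.

Lemma all_lt_leq (m n : nat) (s : seq nat) :
  m <= n -> all (fun a => a < m) s -> all (fun a => a < n) s.
Proof. by move=> le /allP H; apply/allP => a /H; lia. Qed.

Lemma lt_notin m s : all (fun a => a < m) s -> forall r, m <= r -> r \notin s.
Proof. by move=> /allP H r le; apply/negP => /H; lia. Qed.

Fixpoint upds (s : nat -> nat) j ys := if ys is y :: ys' then upds (upd s j y) j.+1 ys' else s.

Lemma updsE s j ys r :
  upds s j ys r = if j <= r < j + size ys then nth 0 ys (r - j) else s r.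
Proof.
elim: ys s j => [|y ys IH] s j /=; first by rewrite addn0; case: ifP => //; lia.
rewrite IH; case: ifP => h1; case: ifP => h2; try lia.
- by rewrite -[r - j]prednK //=; [congr nth; lia | lia].
- by have -> : r = j by [lia]; rewrite /upd eqxx subnn.
by rewrite /upd; case: eqP => //; lia.
Qed.

Lemma compiles_correct gs args fr j s ys :
  foldr (fun g A => compiled g /\ A) True gs ->
  all (fun a => a < j) args -> j + size gs <= fr ->
  (forall r, j <= r -> s r = 0) -> evals gs (map s args) ys ->
  runs (compiles compile args fr gs j) s (upds s j ys).
Proof.
elim: gs j s ys => [|g gs IH] j s ys /= H ltargs lefr s0 ev; inversion ev; subst.
  exact: runs_halt.
case: H => gP gsP; have nj := lt_notin ltargs (leqnn j).
have fr0 r : fr <= r -> s r = 0 by move=> ler; apply: s0; lia.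
apply: runs_app.
  apply: (gP _ _ _ _ y) => //; first by apply: all_lt_leq ltargs; lia.
  - by lia.
  - by apply: s0.
apply: IH => //; first by apply: all_lt_leq ltargs; lia.
- by lia.
- by move=> r ler; rewrite /upd; case: eqP => [|_]; [lia|apply: s0; lia].
by rewrite map_upd.
Qed.

Lemma compiled_prec f g : compiled f -> compiled g -> compiled (CPrec f g).
Proof.
move=> fP gP [|a args] out fr s y /=; first by move=> _ _ _ _ _ ev; inversion ev.
case/andP=> lta ltargs ltout; rewrite inE negb_or => /andP[neqa nout] out0 s0 ev.
(* [v j] is the value of the recursion at [j], read off from the nested evaluations. *)
have [v [v0 vS vk]] : exists v, [/\ eval f (map s args) (v 0),
    forall j, j < s a -> eval g [:: j, v j & map s args] (v j.+1) & v (s a) = y].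
  elim: (s a) y ev => [|k IH] y ev.
    by inversion ev; subst; exists (fun=> y).
  inversion ev as [| | | | |? ? ? ? z ? evk evg|]; subst.
  have [v [v0 vS vk]] := IH _ evk; subst.
  exists (fun j => if j <= k then v j else y); rewrite /= ltnn; split=> //.
  move=> j lej; have [->|neq] := eqVneq j k; first by rewrite leqnn ltnn.
  have ltj : j < k by lia.
  by rewrite ltj (ltnW ltj); apply: vS.
have nargs := lt_notin ltargs.
(* Before iteration [j], [fr] holds the index, [fr.+1] the current value and [fr + 3] the number of
   iterations left; [fr.+2] will receive the new value. *)
pose st j := upd (upd (upd s fr j) fr.+1 (v j)) (fr + 3) (s a - j).
apply: (@runs_app _ _ _ (upd s fr.+1 (v 0))).
  apply: fP => //; first by apply: all_lt_leq ltargs; lia.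
  - by lia.
  - by apply: nargs; lia.
  - by apply: s0; lia.
  by move=> r ler; apply: s0; lia.
apply: (@runs_app _ _ _ (st 0)).
  have -> : st 0 = upd (upd s fr.+1 (v 0)) (fr + 3) ((upd s fr.+1 (v 0)) (fr + 3) + (upd s fr.+1 (v 0)) a).
    have e1 : s fr = 0 by apply: s0.
    have e2 : s (fr + 3) = 0 by apply: s0; lia.
    by rewrite /st; upd_ext.
  apply: runs_copy; rewrite /upd; try (apply/eqP; lia).
  by case: eqP => [|_]; [lia|apply: s0; lia].
apply: (@runs_app _ _ _ (st (s a))).
  apply: runs_loop; last by rewrite /st /upd eqxx subnn.
  move=> j ltj; split; first by rewrite /st /upd eqxx; lia.
  set t := upd _ _ _.
  have tE : t = upd (upd (upd s fr j) fr.+1 (v j)) (fr + 3) (s a - j.+1).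
    by rewrite /t /st; upd_ext.
  have t2 : t fr.+2 = 0 by rewrite tE /upd; do 3![case: eqP => [|_]; first lia]; apply: s0; lia.
  apply: (@runs_app _ _ _ (upd t fr.+2 (v j.+1))).
    apply: gP => //=.
    + by rewrite !andbA; apply/andP; split; [lia|apply: all_lt_leq ltargs; lia].
    + by lia.
    + by rewrite !inE !negb_or; do 2![apply/andP; split; first by apply/eqP; lia]; apply: nargs; lia.
    + by move=> r ler; rewrite tE /upd; do 3![case: eqP => [|_]; first lia]; apply: s0; lia.
    have -> : t fr = j by rewrite tE /upd; do 2![case: eqP => [|_]; first lia]; rewrite eqxx.
    have -> : t fr.+1 = v j by rewrite tE /upd; case: eqP => [|_]; [lia|rewrite eqxx].
    by rewrite tE !map_upd; [exact: vS | apply: nargs; lia ..].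
  apply: (@runs_app _ _ _ _ _ (runs_clear _ _)).
  apply: (@runs_app _ _ _ _ _ (runs_move _ _)); first by apply/eqP; lia.
  set w := upd _ _ _; have -> : st j.+1 = upd w fr (w fr).+1; last exact: runs_inc.
  rewrite /w /st {w}; clear -tE t2 s0; rewrite tE in t2 *.
  have e2 : s fr.+2 = 0 by apply: s0; lia.
  by upd_ext.
apply: runs_app; first exact: runs_clear.
have -> : upd s out y = upd (upd (upd (st (s a)) fr 0) out ((upd (st (s a)) fr 0) out + (upd (st (s a)) fr 0) fr.+1)) fr.+1 0.
  have e0 : s fr = 0 by apply: s0.
  have e1 : s fr.+1 = 0 by apply: s0; lia.
  have e3 : s (fr + 3) = 0 by apply: s0; lia.
  by rewrite /st -vk; upd_ext.
by apply: runs_move; apply/eqP; lia.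
Qed.

Lemma compiled_mu f : compiled f -> compiled (CMu f).
Proof.
move=> fP args out fr s y ltargs ltout nout out0 s0 ev.
inversion ev as [| | | | | |? ? ? evy evm]; subst.
have nargs := lt_notin ltargs.
(* [fr] holds the candidate and [fr.+2] a flag that is 1 while the search goes on. The pass for [y]
   succeeds, keeps the candidate and leaves the flag down. *)
pose st k := upd (upd s fr (if k <= y then k else y)) fr.+2 (if k <= y then 1 else 0).
apply: (@runs_app _ _ _ (st 0)).
  have -> : st 0 = upd s fr.+2 (s fr.+2).+1.
    have e0 : s fr = 0 by apply: s0.
    have e2 : s fr.+2 = 0 by apply: s0; lia.
    by rewrite /st; upd_ext.
  exact: runs_inc.
apply: (@runs_app _ _ _ (st y.+1)).
  apply: runs_loop; last by rewrite /st /upd eqxx ltnn.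
  move=> k; rewrite ltnS => lek; split; first by rewrite /st /upd eqxx lek.
  set t := upd _ _ _.
  have tE : t = upd (upd s fr k) fr.+2 0 by rewrite /t /st lek; upd_ext.
  have t1 : t fr.+1 = 0 by rewrite tE /upd; do 2![case: eqP => [|_]; first lia]; apply: s0; lia.
  have [z [zE z0]] : exists z, eval f (k :: map s args) z /\ (z == 0) = (k == y).
    move: lek; rewrite leq_eqVlt => /predU1P[->|ltk]; first by exists 0; rewrite !eqxx.
    have [z zE] := evm _ ltk; exists z.+1; split=> //.
    by rewrite (ltn_eqF ltk).
  apply: (@runs_app _ _ _ (upd t fr.+1 z)).
    apply: fP => //=.
    + by apply/andP; split; [lia|apply: all_lt_leq ltargs; lia].
    + by lia.
    + by rewrite !inE negb_or; apply/andP; split; [apply/eqP; lia|apply: nargs; lia].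
    + by move=> q leq; rewrite tE /upd; do 2![case: eqP => [|_]; first lia]; apply: s0; lia.
    have -> : t fr = k by rewrite tE /upd; case: eqP => [|_]; [lia|rewrite eqxx].
    by rewrite tE !map_upd; [exact: zE | apply: nargs; lia ..].
  have e0 : s fr = 0 by apply: s0.
  have e1 : s fr.+1 = 0 by apply: s0; lia.
  have e2 : s fr.+2 = 0 by apply: s0; lia.
  (* The inner loop is a conditional: it clears its own register, so its body runs at most once. *)
  pose w j := if j == 0 then upd t fr.+1 z else st k.+1.
  have [zz|zn] := eqVneq z 0.
    have ky : k = y by apply/eqP; rewrite -z0 zz.
    have := @runs_loop fr.+1 (papp (clear fr.+1) (PInc fr (PInc fr.+2 Halt))) (fun=> upd t fr.+1 z) 0.
    have -> : st k.+1 = upd t fr.+1 z by rewrite tE /st ky ltnn zz; upd_ext.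
    by apply=> //; rewrite /upd eqxx.
  have ltk : k < y by rewrite ltn_neqAle lek -z0 zn.
  have := @runs_loop fr.+1 (papp (clear fr.+1) (PInc fr (PInc fr.+2 Halt))) w 1.
  rewrite /w /=; apply.
    move=> [|//] _ /=; split; first by rewrite /upd eqxx.
    apply: (@runs_app _ _ _ _ _ (runs_clear _ _)).
    set u := upd _ _ _.
    apply: (@runs_app (PInc fr Halt) (PInc fr.+2 Halt) _ _ _ (runs_inc _ _)).
    have -> : st k.+1 = upd (upd u fr (u fr).+1) fr.+2 ((upd u fr (u fr).+1) fr.+2).+1.
      by rewrite /u tE /st ltk; upd_ext.
    exact: runs_inc.
  by rewrite /st ltk /upd; do 2![case: eqP => [|_]; first lia].
have -> : upd s out y = upd (upd (st y.+1) out ((st y.+1) out + (st y.+1) fr)) fr 0.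
  have e0 : s fr = 0 by apply: s0.
  have e2 : s fr.+2 = 0 by apply: s0; lia.
  by rewrite /st ltnn; upd_ext.
by apply: runs_move; apply/eqP; lia.
Qed.

Lemma compile_correct c : compiled c.
Proof.
elim/code_ind_nested: c => [||i|f gs fP gsP|f g|f].
- move=> args out fr s y _ _ _ out0 _ ev; inversion ev; subst.
  rewrite (_ : upd s out 0 = s); first exact: runs_halt.
  by upd_ext.
- move=> [|a args] out fr s y /=.
    move=> _ _ _ out0 _ ev; inversion ev; subst.
    by have := @runs_inc out s; rewrite out0.
  case/andP=> lta _ ltout; rewrite inE negb_or => /andP[neq _] out0 s0 ev.
  inversion ev; subst.
  apply: (@runs_app _ _ _ (upd s out (s out + s a))).
    by apply: runs_copy; rewrite ?s0 //; apply/eqP; lia.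
  by have := @runs_inc out (upd s out (s out + s a)); congr runs; upd_ext.
- move=> args out fr s y ltargs ltout nout out0 s0 ev; inversion ev; subst => /=.
  case: ltnP => lti.
    rewrite (nth_map 0) // -[s (nth _ _ _)]add0n -{2}out0.
    have ain := mem_nth 0 lti; have lta := allP ltargs _ ain.
    apply: runs_copy; rewrite ?s0 // ?neq_ltn ?lta ?ltout //.
    by rewrite -neq_ltn; apply: contraNneq nout => <-.
  rewrite nth_default ?size_map // (_ : upd s out 0 = s); first exact: runs_halt.
  by upd_ext.
- move=> args out fr s y ltargs ltout nout out0 s0 ev.
  inversion ev as [| | |? ? ? ys ? evg evf| | |]; subst.
  have szys : size ys = size gs.
    by elim: (gs) (ys) (evg) => [|g gs' IH] ys' e; inversion e; subst => //=; rewrite (IH ys0).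
  apply: (@runs_app _ _ _ (upds s fr ys)).
    exact: compiles_correct.
  apply: (@runs_app _ _ _ (upd (upds s fr ys) out y)).
    apply: fP.
    + by apply/allP=> r; rewrite mem_iota => /andP[].
    + by lia.
    + by rewrite mem_iota; lia.
    + by rewrite updsE; case: ifP => //; lia.
    + by move=> r ler; rewrite updsE; case: ifP => [|_]; [lia|apply: s0; lia].
    rewrite (_ : map _ _ = ys) //; apply: (@eq_from_nth _ 0).
      by rewrite size_map size_iota.
    move=> i; rewrite size_map size_iota => lti.
    rewrite (nth_map 0) ?size_iota // nth_iota // updsE szys.
    by case: ifP => [_|]; [congr nth; lia | lia].
  have := runs_clears (iota fr (size gs)) (upd (upds s fr ys) out y).
  congr runs; apply: functional_extensionality => r; rewrite mem_iota /upd updsE szys.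
  case: ifP => h; case: eqP => // ?; first by lia.
    by rewrite s0 //; lia.
  by rewrite h.
- exact: compiled_prec.
exact: compiled_mu.
Qed.

(** * Transition systems of programs *)

Fixpoint prog_code p :=
  match p with
  | Halt => CodeSeq.code [::]
  | PInc i r => CodeSeq.code [:: i; prog_code r]
  | PLoop i b r => CodeSeq.code [:: i; prog_code b; prog_code r]
  end.

Lemma prog_code_inj : injective prog_code.
Proof.
have codeI := can_inj CodeSeq.codeK.
elim=> [|i p IH|i b IHb p IH] [|i' p'|i' b' p'] // /codeI //.
- by case=> -> /IH ->.
by case=> -> /IHb -> /IH ->.
Qed.

(* Even positive numbers name programs, odd numbers the states [chain_state j] of the
   chain of increments that loads the input, and [0] is the start state of a round. *)
Definition prog_state p := (prog_code p).*2.+2.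
Definition chain_state j := j.*2.+1.

Lemma prog_state_inj : injective prog_state.
Proof. by move=> p q [/double_inj /prog_code_inj]. Qed.

(** The continuation [K] is carried along because a loop body is followed by the loop itself. *)
Fixpoint prog_transitions p K : seq transition :=
  match p with
  | Halt => [::]
  | PInc i r =>
      (prog_state (papp (PInc i r) K), prog_state (papp r K), (Inc, i)) :: prog_transitions r K
  | PLoop i b r =>
      let L := papp (PLoop i b r) K in
      [:: (prog_state L, prog_state (papp r K), (Zero, i)),
          (prog_state L, prog_state (papp b L), (Dec, i))
        & prog_transitions b L ++ prog_transitions r K]
  end.

Lemma prog_transitions_sound p K A B a i :
  List.In (A, B, (a, i)) (prog_transitions p K) ->
  exists q q', [/\ A = prog_state q, B = prog_state q' & edge q a i q'].
Proof.
elim: p K => [//|j r IH|j b IHb r IH] K /=.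
  case=> [[<- <- <- <-]|/IH //].
  by do 2!eexists; split; constructor.
case=> [[<- <- <- <-]|[[<- <- <- <-]|]].
- by do 2!eexists; split; constructor.
- by do 2!eexists; split; try reflexivity; exact: edge_enter.
by rewrite In_cat => -[/IHb|/IH].
Qed.

(** States reached in an execution are concatenations of subprograms; this invariant says that the
    transitions of each piece are present, and it is stable under edges. *)
Inductive covered (T : seq transition) : prog -> Prop :=
| covered_halt : covered T Halt
| covered_app p K :
    (forall x, List.In x (prog_transitions p K) -> List.In x T) ->
    covered T K -> covered T (papp p K).

Lemma covered_edge T q a i q' : covered T q -> edge q a i q' ->
  List.In (prog_state q, prog_state q', (a, i)) T /\ covered T q'.
Proof.
move=> cov; elim: cov a i q' => {q} [|p K sub covK IH] a i q' ed; first by inversion ed.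
case: p sub ed => [|j r|j b r] sub ed; first exact: IH.
  inversion ed; subst; split; first by apply: sub; left.
  by apply: covered_app => // x xr; apply: sub; right.
inversion ed; subst; split.
- by apply: sub; left.
- by apply: covered_app => // x xr; apply: sub; do 2!right; rewrite In_cat; right.
- by apply: sub; right; left.
apply: (@covered_app T b (papp (PLoop i b r) K)).
  by move=> x xb; apply: sub; do 2!right; rewrite In_cat; left.
exact: covered_app sub covK.
Qed.

(** The final loop restores the register it decrements, so it is left at once on result 0 and never
    on any other result. *)
Definition main_prog c := papp (compile c [:: 0] 1 2) (PLoop 1 (PInc 1 Halt) Halt).

Fixpoint chain x : seq transition :=
  if x is x'.+1 then (chain_state x, chain_state x', (Inc, 0)) :: chain x' else [::].

(** The part of the machine that does not depend on the input. *)
Definition body c : seq transition :=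
  (chain_state 0, prog_state (main_prog c), (Zero, 1)) :: prog_transitions (main_prog c) Halt.

Definition machine c x : seq transition :=
  (0, chain_state x, (Zero, 1)) :: chain x ++ body c.

Definition input_state x := upd (fun=> 0) 0 x.

Lemma In_chain x t :
  List.In t (chain x) <-> exists2 j, j < x & t = (chain_state j.+1, chain_state j, (Inc, 0)).
Proof.
elim: x => [|x IH] /=; first by split=> // -[].
split=> [[<-|/IH[j ltj tE]]|[j ltj tE]].
- by exists x.
- by exists j => //; rewrite ltnS ltnW.
move: ltj; rewrite ltnS leq_eqVlt => /predU1P[jx|ltj]; first by left; rewrite tE jx.
by right; apply/IH; exists j.
Qed.

Lemma upd_id s i v : s i = v -> upd s i v = s.
Proof. by move=> <-; upd_ext. Qed.

(** The numbering of states keeps the start, the loading of the input and the execution of the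
    program apart. *)
Lemma machine_sound c x n A s : honest (machine c x) n A s ->
  [\/ [/\ n = 0, A = 0 & s = fun=> 0],
      exists j, [/\ j <= x, n = (x - j).+1, A = chain_state j & s = input_state (x - j)]
    | exists m q, [/\ n = m + x.+2, A = prog_state q & exec (main_prog c) (input_state x) m q s]].
Proof.
elim=> {n A s} [|n A s B a i tT _ IH ok]; first by constructor 1.
move: tT; rewrite /machine /body /= => -[[AE BE aE iE]|].
  subst; case: IH => [[-> _ sE]|[j [_ _ //]]|[m [q [_ //]]]].
  constructor 2; exists x; rewrite subnn sE; split=> //.
  by rewrite /input_state; upd_ext.
rewrite In_cat => -[/In_chain[j ltj [AE BE aE iE]]|[[AE BE aE iE]|]].
- subst; case: IH => [[_ //]|[j' [lej' nE [AE] sE]]|[m [q [_ AE _]]]]; last by move: AE; rewrite /chain_state /prog_state; lia.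
  have {AE} jE : j' = j.+1 by lia.
  subst; constructor 2; exists j; split=> //; [lia|lia|].
  by rewrite /input_state /=; upd_ext.
- subst; case: IH => [[_ //]|[j' [lej' nE [AE] sE]]|[m [q [_ AE _]]]]; last by move: AE; rewrite /chain_state /prog_state; lia.
  have {AE} jE : j' = 0 by lia.
  subst; constructor 3; exists 0, (main_prog c); split=> //; first lia.
  by rewrite upd_id // subn0; constructor.
case/prog_transitions_sound=> q [q' [AE BE ed]].
subst; case: IH => [[_ //]|[j' [_ _ AE _]]|[m [q1 [nE AE e]]]].
  by move: AE; rewrite /chain_state /prog_state; lia.
have qE := prog_state_inj AE; subst.
constructor 3; exists m.+1, q'; split; [lia|by []|].
exact: execS e ed ok.
Qed.

Lemma machine_load c x j : j <= x ->
  honest (machine c x) (x - j).+1 (chain_state j) (input_state (x - j)).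
Proof.
move=> lej; rewrite [chain_state j](_ : _ = chain_state (x - (x - j))); last by rewrite subKn.
move: (x - j) (leq_subr j x) => d {j lej}; elim: d => [_|d IH ltd].
  rewrite subn0; have -> : input_state 0 = upd (fun=> 0) 1 (act_apply Zero 0).
    by rewrite /input_state; upd_ext.
  by apply: (@honestS _ 0 0 _ _ Zero 1) => //; [left | exact: honest0].
have -> : input_state d.+1 = upd (input_state d) 0 (act_apply Inc (input_state d 0)).
  by rewrite /input_state; upd_ext.
apply: (honestS _ (IH (ltnW ltd))) => //.
right; rewrite In_cat; left; apply/In_chain; exists (x - d.+1); first by lia.
by rewrite subnSK.
Qed.

Lemma machine_complete c x m q s :
  exec (main_prog c) (input_state x) m q s ->
  covered (machine c x) q /\ honest (machine c x) (m + x.+2) (prog_state q) s.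
Proof.
elim=> {m q s} [|m q s a i r e [cov hon] ed ok].
  split.
    rewrite -[main_prog c]papp_halt; apply: covered_app; last exact: covered_halt.
    by move=> t tP; right; rewrite In_cat; right; right.
  have := machine_load c (leq0n x); rewrite subn0 => hon.
  have := honestS (B := prog_state (main_prog c)) (a := Zero) (i := 1) _ hon.
  rewrite (upd_id (v := act_apply Zero (input_state x 1))) //.
  by apply=> //; right; rewrite In_cat; right; left.
have [tT cov'] := covered_edge cov ed.
by split=> //; rewrite addSn; apply: honestS tT hon ok.
Qed.

Lemma main_prog_result c x y : eval c [:: x] y ->
  exists n, exec (main_prog c) (input_state x) n (PLoop 1 (PInc 1 Halt) Halt)
    (upd (input_state x) 1 y).
Proof.
by move=> ev; apply: compile_correct => //=; case.
Qed.

Lemma machine_halts c x : eval c [:: x] 0 ->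
  exists t, forall n A s, honest (machine c x) n A s -> n <= t.
Proof.
case/main_prog_result=> N e.
have {}e := execS e (edge_exit _ _ _) (erefl _).
exists (N.+1 + x.+2) => n A s /machine_sound[[-> _ _]|[j [lej -> _ _]]|[m [q [-> _ e']]]] //.
  by lia.
by rewrite leq_add2r; apply: exec_halt e e'.
Qed.

Lemma machine_diverges c x y : eval c [:: x] y.+1 ->
  forall n, exists A s, honest (machine c x) n A s.
Proof.
case/main_prog_result=> N e n.
have [m [q [s [lem /machine_complete[_ hon]]]]] : exists m q s, n <= m /\
    exec (main_prog c) (input_state x) m q s.
  (* Each turn of the final loop takes two steps. *)
  suff [s [sN e']] : exists s, s 1 != 0 /\ exec (main_prog c) (input_state x) (N + n.*2)
      (PLoop 1 (PInc 1 Halt) Halt) s.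
    by exists (N + n.*2), (PLoop 1 (PInc 1 Halt) Halt), s; split=> //; lia.
  elim: n => [|n [s [sN e']]]; first by exists (upd (input_state x) 1 y.+1); rewrite addn0.
  have {}e' := execS e' (edge_enter _ _ _) sN.
  have {}e' := execS e' (edge_inc _ _) (erefl _).
  eexists; split; last by rewrite doubleS !addnS; exact: e'.
  by rewrite /upd eqxx.
have {}lem : n <= m + x.+2 by lia.
move: (m + x.+2) (prog_state q) lem hon => l A lem hon.
(* Cutting a long honest run yields one of length exactly [n]. *)
elim: l A s lem hon => [|l IH] A s' lel hon.
  by move: lel; rewrite leqn0 => /eqP ->; exists A, s'.
move: lel; rewrite leq_eqVlt => /predU1P[->|ltl]; first by exists A, s'.
inversion hon as [|n1 A1 s1 B1 a1 i1 tT hon1 ok1]; subst.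
exact: IH hon1.
Qed.

(** * The encoded grammars are computable from their input *)

(** The minimum 2 covers registers 0 and 1 of the loading phase, so the bound for [body c] serves
    for every input. *)
Definition reg_bound (T : seq transition) := foldr (fun t m => maxn t.2.2.+1 m) 2 T.

Lemma reg_bound_ge2 T : 2 <= reg_bound T.
Proof. by elim: T => //= t T IH; rewrite leq_max IH orbT. Qed.

Lemma reg_bound_lt T t : List.In t T -> t.2.2 < reg_bound T.
Proof.
elim: T => //= t' T IH [->|/IH lti]; first by rewrite leq_max leqnn.
by rewrite leq_max lti orbT.
Qed.

Lemma machine_lt c x A B a i :
  List.In (A, B, (a, i)) (machine c x) -> i < reg_bound (body c).
Proof.
have ge2 := reg_bound_ge2 (body c).
case=> [[_ _ _ <-] //|/In_cat[/In_chain[j _ [_ _ _ ->]]|]]; first exact: ltnW.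
exact: reg_bound_lt.
Qed.

Definition machine_grammar c x := grammar (machine c x) (reg_bound (body c)).

Definition rules_code (ps : seq production) := CodeSeq.code [seq pickle (raw_prod p) | p <- ps].

Definition grammar_code c :=
  rules_code (transition_rules (body c) ++ base_rules (reg_bound (body c))).

Definition push_code A B f :=
  pair_code (pair_code (pair_code 0 (pair_code (pair_code
    (pair_code (pair_code A (pair_code B 0)) (pair_code f 0)) 0) 0)) 0) (pair_code 0 0).

Definition transition_code A B f r :=
  pair_code (push_code (3 * A) (3 * B) f) (pair_code (push_code (3 * B) 0 (op_index Round)) r).

Lemma rules_code_transition t T ps :
  rules_code (transition_rules (t :: T) ++ ps) =
  transition_code t.1.1 t.1.2 (op_index (Act t.2.1 t.2.2))
    (rules_code (transition_rules T ++ ps)).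
Proof. by []. Qed.

(** Only the rules of the chain depend on [x]; they are put by iteration in front of [r], the code
    of the fixed rules. *)
Definition input_code ms x r :=
  pair_code (pair_code 2 (pair_code (pair_code 14 (pair_code
    (transition_code 0 (chain_state x) (op_index (Act Zero 1))
      (iteri x (fun j => transition_code (chain_state j.+1) (chain_state j)
        (op_index (Act Inc 0))) r)) 0)) 0)) (pair_code ms 0).

Lemma encode_machine c x :
  encode_input (machine_grammar c x) letters =
  input_code (pickle (map (@raw_mx 2) letters)) x (grammar_code c).
Proof.
have pickleE (d s : nat) ps (m : seq (seq (seq rat))) :
  pickle (d, (s, [seq raw_prod p | p <- ps]), m) =
  pair_code (pair_code d (pair_code (pair_code s (pair_code (rules_code ps) 0)) 0)) (pair_code (pickle m) 0).
  by rewrite /rules_code (map_comp pickle raw_prod).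
rewrite /encode_input pickleE /input_code.
suff -> : rules_code (prods (machine_grammar c x)) =
    transition_code 0 (chain_state x) (op_index (Act Zero 1))
      (iteri x (fun j => transition_code (chain_state j.+1) (chain_state j)
        (op_index (Act Inc 0))) (grammar_code c)) by [].
rewrite /machine_grammar /grammar [prods _]/(_ ++ _) /machine rules_code_transition.
congr transition_code; elim: x => [|x IH]; first by [].
have -> : chain x.+1 ++ body c =
  (chain_state x.+1, chain_state x, (Inc, 0)) :: (chain x ++ body c) by [].
by rewrite rules_code_transition IH.
Qed.

Lemma computable_transition n A B f r :
  computable n A -> computable n B -> computable n r ->
  computable n (fun xs => transition_code (A xs) (B xs) f (r xs)).
Proof.
move=> AP BP rP; have cP := computable_const n.
have pushP A' B' f' : computable n A' -> computable n B' ->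
    computable n (fun xs => push_code (A' xs) (B' xs) f').
  by move=> A'P B'P; rewrite /push_code; repeat first [exact: cP | assumption | apply: computable_pair].
have mulP g : computable n g -> computable n (fun xs => 3 * g xs) by apply: computable_mul.
rewrite /transition_code; apply: computable_pair; first by apply: pushP; apply: mulP.
by apply: computable_pair => //; apply: pushP => //; apply: mulP.
Qed.

(** Using one argument both as input and as code of the fixed rules provides the
    self-application. *)
Lemma computable_input_code ms : computable 1 (fun xs => input_code ms (nth 0 xs 0) (nth 0 xs 0)).
Proof.
have cP := computable_const 1.
have chainP n f : computable n f -> computable n (fun xs => chain_state (f xs)).
  move=> fP; rewrite /chain_state; apply: computable_succ.
  by apply: computable_ext (computable_add fP fP) _ => xs _; rewrite addnn.
rewrite /input_code; apply: computable_pair; last by apply: computable_pair; exact: cP.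
do 2!(apply: computable_pair; first exact: cP; apply: computable_pair; last exact: cP).
apply: computable_transition => //; first by apply: chainP; computable_var.
apply: (computable_iteri (h := fun j r _ => transition_code (chain_state j.+1) (chain_state j) (op_index (Act Inc 0)) r)); try computable_var.
apply: computable_transition; [apply: chainP|apply: chainP|]; try computable_var.
by apply: computable_succ; computable_var.
Qed.

(** * The diagonal argument *)

Local Open Scope ring_scope.

Lemma mem_ideal_gen n (gens : seq {mpoly rat[n]}) g : g \in gens -> ideal_gen gens g.
Proof.
move=> /(nthP 0)[i lti <-]; exists (mkseq (fun j => (j == i)%:R) (size gens)).
rewrite (bigD1 (Ordinal lti)) //= nth_mkseq // eqxx mul1r big1 ?addr0 // => j jN.
rewrite nth_mkseq // (_ : (j == i :> nat) = false) ?mul0r //.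
by apply: contraNF jN => /eqP ji; apply/eqP/val_inj.
Qed.

Theorem theorem2p7 : ~ exists P : code, computes_zariski_closure P.
Proof.
case=> P closureP.
have [ct ctP] := computable_has_nonroot (computable_proj 1 0).
have [ci ciP] := computable_input_code (pickle (map (@raw_mx 2) letters)).
(* On [grammar_code c], this function builds the grammar of its own machine with that very input,
   applies [P] and tests the generators at the all-ones matrix. *)
pose c := CComp ct [:: CComp P [:: ci]].
pose G := machine_grammar c (grammar_code c).
have [|out [gens [evP [outE idealE]]]] := closureP 2%N G letters.
  exact: grammar_terminals.
have ev : eval c [:: grammar_code c] (has_nonroot out).
  apply: ev_comp (ctP [:: out] erefl); constructor; last by constructor.
  apply: ev_comp evP; constructor; last by constructor.
  by rewrite encode_machine; apply: (ciP [:: grammar_code c]).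
have rootE := has_nonrootE outE.
case nE : (has_nonroot out) ev rootE => [|y] ev /esym rootE.
  (* Result 0: all generators vanish at the all-ones matrix, yet the machine halts and the ideal has
     a member nonzero there. *)
  have [t tP] := machine_halts ev.
  have [p pP p1] := image_bounded (@machine_lt c _) tP.
  have /idealE[cs pE] := pP.
  case/eqP: p1; rewrite pE rmorph_sum big1 //= => i _.
  by rewrite mevalM (eqP (allP rootE _ (mem_nth _ (ltn_ord i)))) mulr0.
(* Nonzero result: some generator is nonzero at the all-ones matrix, yet the machine runs forever
   and the whole ideal vanishes there. *)
have hon := machine_diverges ev.
case/negP: rootE; apply/allP=> g gin; apply/eqP.
apply: image_unbounded (@machine_lt c _) hon _.
by apply/idealE; apply: mem_ideal_gen.
Qed.
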